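(* Let $\eta\in L^2(D)$, with expansion $\eta=\sum_{k=0}^\infty\sum_{j\in\mathbb{Z}}c_{j,k}\psi_{j,k}$ in the orthonormal Zernike basis, where $(c_{j,k})\in\ell^2(\mathbb{Z}\times\mathbb{N}_0)$. Then for all $j\in\mathbb{Z}$ and $k\in\mathbb{N}_0$, $$c_{j,k} = -\sqrt{\pi(|j|+2k+1)}\,\binom{|j|+2k}{k}\,\bigl\langle (F\eta)f_{\operatorname{sgn}(j)(k+1)},\,f_{\operatorname{sgn}(j)(|j|+k+1)}\bigr\rangle_{L^2(\partial D)} - \sum_{q=0}^{k-1}c_{j,q}\,\frac{\sqrt{(|j|+2k+1)(|j|+2q+1)}}{|j|+k+q+1}\binom{|j|+2k}{k-q}.$$
   Context: All function spaces are complex-valued and inner products are linear in the first argument. $D$ is the open unit disk in $\mathbb{R}^2\simeq\mathbb{C}$, and $\mathbb{N}_0=\{0,1,2,\dots\}$. Operator $F$: let $L^2_\diamond(\partial D)=\{g\in L^2(\partial D) : \langle g,1\rangle_{L^2(\partial D)}=0\}$. For $f\in L^2_\diamond(\partial D)$, let $u_f\in H^1(D)$ be the (weak) harmonic function in $D$ with Neumann trace $f$ on $\partial D$, normalised by $\int_{\partial D}u_f\,\mathrm{d}S=0$. For $\eta\in L^2(D)$, $F\eta$ is the bounded linear operator on $L^2_\diamond(\partial D)$ defined by $$\langle (F\eta)f,g\rangle_{L^2(\partial D)} = -\int_D \eta\,\nabla u_f\cdot\overline{\nabla u_g}\,\mathrm{d}x,\qquad f,g\in L^2_\diamond(\partial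 D)$$ (the integral is well defined and this is a bounded sesquilinear form). Zernike basis: for $j\in\mathbb{Z}$, $k\in\mathbb{N}_0$, in polar coordinates, $$\psi_{j,k}(r\mathrm{e}^{\mathrm{i}\theta})=\sqrt{\frac{|j|+2k+1}{\pi}}\,R^{|j|}_{|j|+2k}(r)\,\mathrm{e}^{\mathrm{i}j\theta},\qquad R^{|j|}_{|j|+2k}(r)=\sum_{q=0}^k(-1)^q\binom{|j|+2k-q}{q}\binom{|j|+2k-2q}{k-q}r^{|j|+2k-2q}.$$ The family $\{\psi_{j,k}\}_{j\in\mathbb{Z},k\in\mathbb{N}_0}$ is an orthonormal basis of $L^2(D)$. Boundary functions: $f_m(\mathrm{e}^{\mathrm{i}\theta})=\frac{1}{\sqrt{2\pi}}\mathrm{e}^{\mathrm{i}m\theta}$ for $m\in\mathbb{Z}$. The sign function $\operatorname{sgn}$ uses the convention $\operatorname{sgn}(0)=1$. An empty sum equals $0$. *)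

(* Defs.v *)
From HB Require Import structures.
From mathcomp Require Import all_boot all_order all_algebra finmap.
From mathcomp Require Import all_classical all_reals all_analysis.
From mathcomp Require Import complex.

Set Implicit Arguments.
Unset Strict Implicit.
Unset Printing Implicit Defensive.

Import Order.TTheory GRing.Theory Num.Theory.
Import numFieldNormedType.Exports.

Local Open Scope classical_set_scope.
Local Open Scope ring_scope.
Local Open Scope complex_scope.

Section ComplexIntegration.
Context {d : measure_display} {T : measurableType d} {R : realType}.
Implicit Types (mu : {measure set T -> \bar R}) (A : set T) (f g : T -> R[i]).

Definition cmeasurable_fun A f : Prop :=
  measurable_fun A (fun x => complex.Re (f x)) /\
  measurable_fun A (fun x => complex.Im (f x)).

Definition cintegral mu A f : R[i] :=
  Rintegral mu A (fun x => complex.Re (f x)) +i*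
  Rintegral mu A (fun x => complex.Im (f x)).

(* The squared L^2 norm is kept in [\bar R], so that bounds and limits of it
   never hold because of a default value. *)
Definition sqnorm mu A f : \bar R :=
  (\int[mu]_(x in A) (complex.Re (f x) ^+ 2 + complex.Im (f x) ^+ 2)%:E)%E.

Definition L2 mu A f : Prop :=
  cmeasurable_fun A f /\ (sqnorm mu A f < +oo)%E.

Definition inner mu A f g : R[i] := cintegral mu A (fun x => f x * (g x)^*).

End ComplexIntegration.

Section Disk.
Context {R : realType}.

Definition area : {measure set (measurableTypeR R * measurableTypeR R) -> \bar R} :=
  (@lebesgue_measure R \x @lebesgue_measure R)%E.

Definition disk : set (R * R) := [set x | x.1 ^+ 2 + x.2 ^+ 2 < 1].

Definition disk_L2 (f : R * R -> R[i]) : Prop := L2 area disk f.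

Definition disk_integral (f : R * R -> R[i]) : R[i] := cintegral area disk f.

Definition disk_sqnorm (f : R * R -> R[i]) : \bar R := sqnorm area disk f.

(* Functions on the unit circle are represented by functions on the plane of
   which only the values on the circle matter; arc length is the image of
   Lebesgue measure on [0, 2 pi] under [circle_pt]. *)
Definition circle_pt (t : R) : R * R := (cos t, sin t).

Definition angles : set R := `[0, 2 * pi]%classic.

Definition circle_L2 (f : R * R -> R[i]) : Prop :=
  L2 lebesgue_measure angles (f \o circle_pt).

Definition circle_integral (f : R * R -> R[i]) : R[i] :=
  cintegral lebesgue_measure angles (f \o circle_pt).

Definition circle_sqnorm (f : R * R -> R[i]) : \bar R :=
  sqnorm lebesgue_measure angles (f \o circle_pt).

Definition circle_inner (f g : R * R -> R[i]) : R[i] :=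
  inner lebesgue_measure angles (f \o circle_pt) (g \o circle_pt).

Definition circle_ae_eq (f g : R * R -> R[i]) : Prop :=
  {ae lebesgue_measure,
    forall t : R, angles t -> f (circle_pt t) = g (circle_pt t)}.

Definition circle_L2_mean0 (f : R * R -> R[i]) : Prop :=
  circle_L2 f /\ circle_inner f (fun=> 1) = 0.

Definition basis_vec (i : 'I_2) : R * R := if i == ord0 then (1, 0) else (0, 1).

Fixpoint Ck (n : nat) (f : R * R -> R) : Prop :=
  if n is n'.+1 then
    continuous f /\
    forall i, (forall x, derivable f x (basis_vec i)) /\
              Ck n' (fun x => 'D_(basis_vec i) f x)
  else continuous f.

Definition smooth (f : R * R -> R) : Prop := forall n, Ck n f.

Definition test_fun (phi : R * R -> R) : Prop :=
  smooth phi /\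
  exists K : set (R * R),
    [/\ compact K, K `<=` disk & forall x, ~ K x -> phi x = 0].

(* Real test functions suffice: both sides are complex linear in [phi]. *)
Definition weak_partial (i : 'I_2) (u g : R * R -> R[i]) : Prop :=
  forall phi, test_fun phi ->
    disk_integral (fun x => u x * ('D_(basis_vec i) phi x)%:C) =
    - disk_integral (fun x => g x * (phi x)%:C).

(* An element of H^1 of the disk, bundled with a representative of its weak
   gradient. *)
Record H1 : Type := MkH1 {
  H1_fun :> R * R -> R[i];
  grad : 'I_2 -> R * R -> R[i];
  H1_L2 : disk_L2 H1_fun;
  grad_L2 : forall i, disk_L2 (grad i);
  grad_weak : forall i, weak_partial i H1_fun (grad i)
}.

Definition csmooth (f : R * R -> R[i]) : Prop :=
  smooth (fun x => complex.Re (f x)) /\ smooth (fun x => complex.Im (f x)).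

Definition partial (i : 'I_2) (f : R * R -> R[i]) (x : R * R) : R[i] :=
  'D_(basis_vec i) (fun y => complex.Re (f y)) x +i*
  'D_(basis_vec i) (fun y => complex.Im (f y)) x.

(* [h] is the Dirichlet trace of [u]: the trace operator is the H^1-to-L^2
   continuous extension of the restriction of smooth functions to the circle. *)
Definition is_trace (u : H1) (h : R * R -> R[i]) : Prop :=
  circle_L2 h /\
  exists phi : nat -> R * R -> R[i],
    [/\ forall n, csmooth (phi n),
        disk_sqnorm (fun x => phi n x - u x) @[n --> \oo] --> 0%E,
        forall i, disk_sqnorm (fun x => partial i (phi n) x - grad u i x)
                    @[n --> \oo] --> 0%E
      & circle_sqnorm (fun x => phi n x - h x) @[n --> \oo] --> 0%E].

Definition grad_dot (u v : H1) (x : R * R) : R[i] :=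
  \sum_(i < 2) grad u i x * (grad v i x)^*.

(* [u] is weakly harmonic in the disk with Neumann trace [f], and its
   Dirichlet trace has integral 0 over the circle. *)
Definition neumann_solution (f : R * R -> R[i]) (u : H1) : Prop :=
  (forall (v : H1) (h : R * R -> R[i]), is_trace v h ->
     disk_integral (grad_dot u v) = circle_inner f h) /\
  exists2 h, is_trace u h & circle_integral h = 0.

(* [T] is the operator [F eta].  The defining identity determines [T f] up to
   a null set, and solutions of the Neumann problem together with their
   gradients are themselves unique up to null sets. *)
Record is_F (eta : R * R -> R[i])
    (T : (R * R -> R[i]) -> (R * R -> R[i])) : Prop := {
  F_mean0 : forall f, circle_L2_mean0 f -> circle_L2_mean0 (T f);
  F_linear : forall (a : R[i]) f g, circle_L2_mean0 f -> circle_L2_mean0 g ->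
    circle_ae_eq (T (fun x => a * f x + g x)) (fun x => a * T f x + T g x);
  F_bounded : exists M : R, forall f, circle_L2_mean0 f ->
    (circle_sqnorm (T f) <= M%:E * circle_sqnorm f)%E;
  F_form : forall f g (u v : H1), circle_L2_mean0 f -> circle_L2_mean0 g ->
    neumann_solution f u -> neumann_solution g v ->
    circle_inner (T f) g = - disk_integral (fun x => eta x * grad_dot u v x)
}.

Definition to_complex (x : R * R) : R[i] := x.1 +i* x.2.

Definition radius (x : R * R) : R := Num.sqrt (x.1 ^+ 2 + x.2 ^+ 2).

(* The value at [x] of the angular factor [e^(i j theta)]; at the origin it is
   1 if j = 0 and 0 otherwise. *)
Definition angular (j : int) (x : R * R) : R[i] :=
  (to_complex x / (radius x)%:C) ^ j.

(* The radial polynomial R^m_(m+2k). *)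
Definition zernike_radial (m k : nat) (r : R) : R :=
  \sum_(0 <= q < k.+1)
    (-1) ^+ q * ('C(m + 2 * k - q, q))%:R *
    ('C(m + 2 * k - 2 * q, k - q))%:R * r ^+ (m + 2 * k - 2 * q).

Definition zernike (j : int) (k : nat) (x : R * R) : R[i] :=
  (Num.sqrt ((`|j| + 2 * k + 1)%N%:R / pi) *
   zernike_radial `|j| k (radius x))%:C * angular j x.

Definition fourier (m : int) (x : R * R) : R[i] :=
  ((Num.sqrt (2 * pi))^-1)%:C * angular m x.

Definition ell2 (c : int -> nat -> R[i]) : Prop :=
  (\esum_(p in [set: int * nat])
     (complex.Re (c p.1 p.2) ^+ 2 + complex.Im (c p.1 p.2) ^+ 2)%:E < +oo)%E.

(* Unconditional convergence in L^2 of the disk: the finite partial sums,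
   ordered by inclusion of the index sets, converge to [eta]. *)
Definition zernike_expansion (eta : R * R -> R[i])
    (c : int -> nat -> R[i]) : Prop :=
  forall e : R, 0 < e ->
    exists A0 : {fset int * nat}, forall A : {fset int * nat},
      (A0 `<=` A)%fset ->
      (disk_sqnorm (fun x =>
         eta x - \sum_(p <- A) c p.1 p.2 * zernike p.1 p.2 x)%R < e%:E)%E.

End Disk.

(* The sign function with the convention sgn 0 = 1. *)
Definition sgn (j : int) : int := if 0 <= j then 1 else -1.

(* Main.v *)
(** For [s = 1] the function [w s] is the coordinate z, for [s = -1] it is its
    conjugate.  The Neumann solution for the datum [f_m], with [m = s n] and
    [0 < n], is [w s ^ n / (n sqrt (2 pi))], so for the two data of the theorem
    the form [<F eta f, f'>] is [- 1 / pi] times the integral of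
    [eta * w s ^ k * w (- s) ^ (|j| + k)], where [s] is the sign of j.  Only
    the Zernike functions with angular index j have a nonzero moment against
    this monomial, and the moment of the q-th one is a multiple of the falling
    factorial k (k - 1) ... (k - q + 1); it vanishes for q > k.  The system is
    thus triangular, and solving its k-th equation for [c j k] is the claim.

    Every integral over the disk is reduced to the circle by Green's theorem,
    which also yields, without polar coordinates, the moments of the monomials:
    [2 (b + 1) w s ^ a * w (- s) ^ b] is the image of
    [w s ^ a * w (- s) ^ (b + 1)] under the Cauchy-Riemann operator [dbar s]. *)

Require Import Defs.
From mathcomp Require Import all_boot all_order all_algebra finmap.
From mathcomp Require Import all_classical all_reals all_analysis.
From mathcomp Require Import measurable_realfun complex zify ring lra.

Set Implicit Arguments.
Unset Strict Implicit.
Unset Printing Implicit Defensive.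

Import Order.TTheory GRing.Theory Num.Theory.
Import numFieldNormedType.Exports.

Local Open Scope classical_set_scope.
Local Open Scope ring_scope.
Local Open Scope complex_scope.

(** * Measure on the plane *)

Section PlaneMeasure.
Context {R : realType}.
Notation mR := (measurableTypeR R).
Implicit Types (f g : R * R -> R).

(** Two limits have to be controlled: the test functions of the Neumann problem are known only
    through smooth approximants, and [eta] only through finite partial sums of its expansion. In
    both cases one argument of an inner product is fixed, and [inner_small] bounds the error by a
    weighted arithmetic-geometric mean inequality. The frequencies k + 1 and |j| + k + 1 are chosen
    so that the product of the first gradient with the conjugate of the second has angular frequency
    -j, which selects the index j in the expansion. The falling factorial has the following origin.
    As a function of the summation index s, the k-th moment of the q-th radial polynomial is a q-th
    finite difference of a polynomial of degree q divided by a linear function x - s. Dividing with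
    remainder leaves a polynomial of degree below q, which the difference kills, and the difference
    of 1 / (x - s) times the value of the polynomial at the pole; that value is k (k - 1) ... (k - q
    + 1) up to sign. *)

Lemma open_measurable_plane (U : set (R * R)) :
  open U -> measurable (U : set (mR * mR)).
Proof.
move=> oU.
(* The product sigma-algebra is generated by rectangles, so the open set is written as the countable
   union of the rational open boxes that it contains. *)
pose box (q : (rat * rat) * (rat * rat)) : set (R * R) :=
  `]ratr q.1.1, ratr q.1.2[%classic `*` `]ratr q.2.1, ratr q.2.2[%classic.
pose B q : set (R * R) := if `[< box q `<=` U >] then box q else set0.
suff -> : U = \bigcup_(q in setT) B q.
  apply: (@countable_bigcupT_measurable _ (mR * mR)%type) => // q.
  rewrite /B; case: ifP => // _.
  by apply: measurableX; exact: measurable_itv.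
apply/seteqP; split => [[x y] Uxy|x [q _]]; last first.
  by rewrite /B; case: ifPn => [/asboolP sub|//] /sub.
have /nbhs_ballP[e /= e0 sub] := open_nbhs_nbhs (conj oU Uxy).
have itv (z : R) : exists a b : rat,
    [/\ ratr a < z, z < ratr b, z - e < ratr a & ratr b < z + e].
  have [|a] := @rat_in_itvoo R (z - e) z; first by rewrite ltrBlDr ltrDl.
  have [|b] := @rat_in_itvoo R z (z + e); first by rewrite ltrDl.
  rewrite !in_itv/= => /andP[zb bz] /andP[za az].
  by exists a, b.
have [a [b [az zb za bz]]] := itv x.
have [c [d [cy yd yc dy]]] := itv y.
exists ((a, b), (c, d)) => //; rewrite /B ifT.
  by split; rewrite /= in_itv/=; apply/andP.
apply/asboolP => -[u v] [/= + +]; rewrite !in_itv/= => /andP[u1 u2] /andP[v1 v2].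
apply: sub; split; rewrite /ball/= ltr_distlC.
  by rewrite (lt_trans za u1) (lt_trans u2 bz).
by rewrite (lt_trans yc v1) (lt_trans v2 dy).
Qed.

Lemma continuous_measurable_plane f :
  continuous f -> measurable_fun setT (f : mR * mR -> mR).
Proof.
move=> cf; apply: (measurability _ (measurable_realfun.RGenOpens.measurableE R)).
move=> _ [_ [a [b ->] <-]]; rewrite setTI; apply: open_measurable_plane.
by move/continuousP: cf; apply; exact: interval_open.
Qed.

Lemma measurable_disk : measurable (@disk R : set (mR * mR)).
Proof.
have : measurable_fun setT
    ((fun x : R * R => x.1 ^+ 2 + x.2 ^+ 2) : mR * mR -> mR).
  apply: continuous_measurable_plane => x.
  apply: cvgD; rewrite expr2; apply: cvgM;
    by [exact: cvg_fst|exact: cvg_snd].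
move/(_ measurableT `]-oo, 1[%classic (measurable_itv _)).
by rewrite setTI; congr measurable; apply/seteqP; split => x /=; rewrite /disk/= in_itv.
Qed.

Definition square : set (R * R) := `[-1, 1]%classic `*` `[-1, 1]%classic.

Lemma sqr_le1_itv (a b : R) : a ^+ 2 + b ^+ 2 <= 1 -> -1 <= a <= 1.
Proof.
move=> h; rewrite -ler_norml -(@ler_pXn2r _ 2) ?nnegrE// expr1n real_normK ?num_real//.
by apply: le_trans h; rewrite lerDl sqr_ge0.
Qed.

Lemma disk_square : disk `<=` square.
Proof.
move=> x /ltW dx; split; rewrite /= in_itv/=; first exact: sqr_le1_itv dx.
by rewrite addrC in dx; exact: sqr_le1_itv dx.
Qed.

Lemma area_disk_lty : (area (@disk R) < +oo)%E.
Proof.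
apply: (@le_lt_trans _ _ (area square)).
  apply: le_measure; rewrite ?inE; [exact: measurable_disk| |exact: disk_square].
  by apply: measurableX; exact: measurable_itv.
rewrite /area/= product_measure1E; try exact: measurable_itv.
have : (@lebesgue_measure R `[(-1)%R, 1%R]%classic < +oo)%E.
  by rewrite lebesgue_measure_itv/=; case: ifP => _; rewrite ?ltry// -EFinB ltry.
by move=> h; apply: lte_mul_pinfty => //; rewrite ge0_fin_numE.
Qed.

(** The disk is open, so the bound is taken on the compact [square] around it. *)
Lemma continuous_bounded_disk f : continuous f ->
  [bounded f x | x in (@disk R)].
Proof.
move=> cf.
have cS : compact square by apply: compact_setX; exact: segment_compact.
have /(continuous_compact (f := f)) := cS.
move=> /(_ (continuous_subspaceT cf)) /compact_bounded.
move=> [M [Mr h]]; exists M; split => // t Mt x /disk_square xS.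
by apply: h Mt _ _; exists x.
Qed.

Lemma continuous_integrable_disk f : continuous f ->
  area.-integrable (@disk R) (EFin \o f).
Proof.
move=> cf; apply: measurable_bounded_integrable.
- exact: measurable_disk.
- exact: area_disk_lty.
- exact: (measurable_funS measurableT _ (continuous_measurable_plane cf)).
- exact: continuous_bounded_disk.
Qed.

End PlaneMeasure.

(** * Green's theorem on the disk *)

Section Green.
Context {R : realType}.
Notation mu := (@lebesgue_measure R).
Implicit Types (F f h : R -> R) (G g : R * R -> R).

Lemma continuous_integrable_itv f a b : continuous f ->
  mu.-integrable `[a, b] (EFin \o f).
Proof.
move=> cf; apply: continuous_compact_integrable; first exact: segment_compact.
exact: continuous_subspaceT.
Qed.

Lemma integral_itv_derive F f (a b : R) : a <= b -> continuous f ->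
  (forall x : R, a <= x <= b -> is_derive x 1 F (f x)) ->
  (\int[mu]_(x in `[a, b]) (f x)%:E = (F b - F a)%:E)%E.
Proof.
rewrite le_eqVlt => /predU1P[<-|ab] cf dF.
  by rewrite set_itv1 integral_set1 subrr.
have cF x : a <= x <= b -> {for x, continuous F}.
  move=> /dF[dFx _]; apply/differentiable_continuous.
  exact/derivable1_diffP.
rewrite (@continuous_FTC2 _ _ F) ?EFinB//.
- exact: continuous_subspaceT.
- split.
  + by move=> x; rewrite in_itv/= => /andP[ax xb]; case: (dF x); rewrite ?(ltW ax) ?ltW.
  + by apply: cvg_at_right_filter; apply: cF; rewrite lexx ltW.
  + by apply: cvg_at_left_filter; apply: cF; rewrite lexx ltW.
- move=> x; rewrite in_itv/= => /andP[ax xb]; rewrite derive1E.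
  by apply: derive_val; apply: dF; rewrite !ltW.
Qed.

Lemma Rintegral_itv_derive F f (a b : R) : a <= b -> continuous f ->
  (forall x : R, a <= x <= b -> is_derive x 1 F (f x)) ->
  \int[mu]_(x in `[a, b]) f x = F b - F a.
Proof. by move=> ab cf dF; rewrite /Rintegral (integral_itv_derive ab cf dF). Qed.

Lemma Rintegral_itv_cat f (a b c : R) : a <= b -> b <= c -> continuous f ->
  \int[mu]_(x in `[a, c]) f x =
  \int[mu]_(x in `[a, b]) f x + \int[mu]_(x in `[b, c]) f x.
Proof.
move=> ab bc cf; apply/eqP; rewrite addrC -subr_eq; apply/eqP.
rewrite Rintegral_itvB ?bnd_simp//; last exact: continuous_integrable_itv.
rewrite Rintegral_itv_obnd_cbnd//.
apply: integrableS (continuous_integrable_itv b c cf) => //.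
exact: subset_itv_oc_cc.
Qed.

Lemma continuous_primitive h : continuous h ->
  exists H, forall y : R, -1 <= y <= 1 -> is_derive y 1 H (h y).
Proof.
(* The end points -2 and 2 leave room around [-1, 1], so that the derivative is two-sided at y = -1
   and y = 1 as well, values that sine and cosine attain. *)
move=> ch; exists (fun y => \int[mu]_(t in `[-2, y]) h t) => y /andP[y1 y2].
have [||||dH eH] := @continuous_FTC1_closed _ h (-2) y 2 _ _ _ _.
- by apply: le_lt_trans y2 _; rewrite ltr1n.
- exact: continuous_integrable_itv.
- by apply: lt_le_trans y1; rewrite ltrN2 ltr1n.
- exact: ch.
- by split; [exact: dH | rewrite -derive1E; exact: eH].
Qed.

(** [Num.sqrt] is 0 on negative numbers, so this is continuous on the whole line and vanishes for
    |y| >= 1, where the chord is empty. *)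
Definition half_chord (y : R) : R := Num.sqrt (1 - y ^+ 2).

Lemma continuous_half_chord : continuous half_chord.
Proof.
move=> y; apply: continuous_comp; last exact: sqrt_continuous.
by apply: cvgB; [exact: cvg_cst|exact: exprn_continuous].
Qed.

Lemma half_chord_eq0 y : 1 <= `|y| -> half_chord y = 0.
Proof.
move=> y1; apply/ler0_sqrtr; rewrite subr_le0 -real_normK ?num_real//.
by rewrite -{1}(expr1n _ 2) lerXn2r ?nnegrE.
Qed.

Lemma half_chord_itv x y :
  (x ^+ 2 + y ^+ 2 < 1) = (- half_chord y < x < half_chord y).
Proof.
rewrite -ltrBrDr -ltr_norml -sqrtr_sqr /half_chord.
have [a0|a0] := ltP 0 (1 - y ^+ 2); first by rewrite ltr_sqrt.
rewrite [in RHS](ler0_sqrtr a0) !ltNge sqrtr_ge0/=.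
by rewrite (le_trans a0) ?sqr_ge0.
Qed.

Lemma half_chord_cos t : half_chord (sin t) = `|cos t|.
Proof. by rewrite /half_chord -sqrtr_sqr cos2sin2. Qed.

Lemma half_chord_sin t : half_chord (cos t) = `|sin t|.
Proof. by rewrite /half_chord -sqrtr_sqr sin2cos2. Qed.

Lemma integral_chord F f (y : R) : continuous f ->
  (forall x : R, is_derive x 1 F (f x)) ->
  (\int[mu]_x ((EFin \o f) \_ [set x | x ^+ 2 + y ^+ 2 < 1]%R) x =
   (F (half_chord y) - F (- half_chord y))%:E)%E.
Proof.
move=> cf dF.
set s := half_chord y.
have -> : [set x | x ^+ 2 + y ^+ 2 < 1] = `]- s, s[%classic.
  by apply/seteqP; split => x /=; rewrite in_itv/= half_chord_itv.
rewrite -integral_mkcond.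
have mf D : measurable D -> measurable_fun D (EFin \o f).
  move=> mD; apply/measurable_EFinP.
  exact: measurable_funS (continuous_measurable_fun cf).
rewrite integral_itv_obnd_cbnd; last exact: mf (measurable_itv _).
rewrite integral_itv_bndo_bndc; last exact: mf (measurable_itv _).
by apply: integral_itv_derive => //; rewrite ge0_cp// sqrtr_ge0.
Qed.

(** The two functions agree outside [-1, 1], so the integral of the difference over the line lives
    on that interval, where primitives are available. *)
Lemma integral_chords F1 F2 h1 h2 : continuous h1 -> continuous h2 ->
  (forall y, 1 <= `|y| -> h1 y = h2 y) ->
  (forall y : R, -1 <= y <= 1 -> is_derive y 1 F1 (h1 y)) ->
  (forall y : R, -1 <= y <= 1 -> is_derive y 1 F2 (h2 y)) ->
  (\int[mu]_y (h1 y - h2 y)%:E = ((F1 1 - F2 1) - (F1 (-1) - F2 (-1)))%:E)%E.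
Proof.
move=> c1 c2 h12 d1 d2.
have cB : continuous (h1 \- h2) by move=> y; apply: cvgB; [exact: c1|exact: c2].
have dB (y : R) : -1 <= y <= 1 -> is_derive y 1 (F1 \- F2) ((h1 \- h2) y).
  by move=> yI; apply: is_deriveB; [exact: d1|exact: d2].
have N11 : -1 <= 1 :> R by rewrite ge0_cp.
rewrite -(integral_itv_derive N11 cB dB) [RHS]integral_mkcond.
apply: eq_integral => y _; rewrite patchE; case: ifPn => //.
rewrite notin_setE/= in_itv/= => /negP; rewrite -ler_norml -ltNge => /ltW/h12 ->.
by rewrite subrr.
Qed.

End Green.

Section GreenReal.
Context {R : realType}.
Notation mu := (@lebesgue_measure R).
Notation e1 := ((1, 0) : R * R).
Notation e2 := ((0, 1) : R * R).
Implicit Types (G g : R * R -> R).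

(** The difference quotients of the slice and of the directional derivative are the same function of
    h. *)
Lemma is_derive_slice1 G g (y x : R) : is_derive (x, y) e1 G (g (x, y)) ->
  is_derive x 1 (fun t => G (t, y)) (g (x, y)).
Proof.
have E : (fun h : R => h^-1 *: (((fun t => G (t, y)) \o shift x) (h *: 1) - G (x, y)))
  = (fun h => h^-1 *: ((G \o shift (x, y)) (h *: e1) - G (x, y))).
  apply/funext => h /=; congr (_ *: (G _ - _)).
  by rewrite [RHS]surjective_pairing /= scaler0 add0r.
by move=> [dG eG]; split; rewrite /derivable /derive E.
Qed.

Lemma is_derive_slice2 G g (x y : R) : is_derive (x, y) e2 G (g (x, y)) ->
  is_derive y 1 (fun t => G (x, t)) (g (x, y)).
Proof.
have E : (fun h : R => h^-1 *: (((fun t => G (x, t)) \o shift y) (h *: 1) - G (x, y)))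
  = (fun h => h^-1 *: ((G \o shift (x, y)) (h *: e2) - G (x, y))).
  apply/funext => h /=; congr (_ *: (G _ - _)).
  by rewrite [RHS]surjective_pairing /= scaler0 add0r.
by move=> [dG eG]; split; rewrite /derivable /derive E.
Qed.

Lemma continuous_slice G (u v : R -> R) : continuous G -> continuous u ->
  continuous v -> continuous (fun t => G (u t, v t)).
Proof.
move=> cG cu cv t; apply: (@continuous_comp _ _ _ (fun t => (u t, v t)) G).
  exact: (cvg_pair (cu t) (cv t)).
exact: cG.
Qed.

Lemma continuous_id_fun : continuous (@idfun R). Proof. by move=> x; exact: cvg_id. Qed.

Lemma continuousN_half_chord : continuous (fun y : R => - half_chord y).
Proof. by move=> y; apply: cvgN; exact: continuous_half_chord. Qed.

Lemma continuousM_circle G (c : R -> R) : continuous G -> continuous c ->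
  continuous (fun t => G (cos t, sin t) * c t).
Proof.
move=> cG cc t; apply: cvgM; last exact: cc.
exact: (continuous_slice cG (@continuous_cos R) (@continuous_sin R)).
Qed.

Lemma sin_itv (t : R) : -1 <= sin t <= 1.
Proof. by rewrite sin_geN1 sin_le1. Qed.

Lemma cos_itv (t : R) : -1 <= cos t <= 1.
Proof. by rewrite cos_geN1 cos_le1. Qed.

Lemma area_disk_restrict g : continuous g ->
  area.-integrable setT ((EFin \o g) \_ (@disk R)).
Proof.
move=> cg; apply: (integrable_mkcond (mu := area) (EFin \o g) measurable_disk).1.
exact: continuous_integrable_disk.
Qed.

(* On horizontal chords this is the fundamental theorem of calculus.  The
   resulting integrals in y of [G (+- half_chord y, y)] have primitives [Hp] and
   [Hm], and [Hp \o sin], [Hm \o sin] are primitives of the circle integrand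
   where the cosine is nonnegative, resp. nonpositive. *)
Lemma green_dx G g : continuous G -> continuous g ->
  (forall p, is_derive p e1 G (g p)) ->
  \int[area]_(p in disk) g p =
  \int[mu]_(t in angles) (G (circle_pt t) * cos t).
Proof.
move=> cG cg dG.
pose hp y := G (half_chord y, y); pose hm y := G (- half_chord y, y).
have chp : continuous hp.
  exact: (continuous_slice cG continuous_half_chord continuous_id_fun).
have chm : continuous hm.
  exact: (continuous_slice cG continuousN_half_chord continuous_id_fun).
have [Hp dHp] := continuous_primitive chp.
have [Hm dHm] := continuous_primitive chm.
have -> : \int[area]_(p in disk) g p = (Hp 1 - Hm 1) - (Hp (-1) - Hm (-1)).
  rewrite /Rintegral integral_mkcond -(integral21_prod_meas1 (area_disk_restrict cg)).
  have chords := @integral_chords _ Hp Hm hp hm chp chm _ dHp dHm.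
  rewrite -[RHS]/(fine (_%:E)) -chords; last first.
    by move=> y /half_chord_eq0 hy; rewrite /hp /hm hy oppr0.
  congr fine; apply: eq_integral => y _.
  have cs := continuous_slice cg continuous_id_fun (@cst_continuous R R y).
  rewrite -(integral_chord y cs (fun x => is_derive_slice1 (dG (x, y)))).
  by apply: eq_integral => x _; rewrite !patchE.
have cI : continuous (fun t => G (circle_pt t) * cos t).
  by apply: continuousM_circle => //; exact: continuous_cos.
have pi0 := pi_gt0 R.
(* The cosine changes sign at pi / 2 and at pi / 2 + pi. *)
rewrite /angles (@Rintegral_itv_cat _ _ 0 (pi / 2)) ?divr_ge0 ?ltW//; last by lra.
rewrite (@Rintegral_itv_cat _ _ (pi / 2) (pi / 2 + pi)) ?divr_ge0 ?ltW//; [|lra|lra].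
have sin32 : sin (pi / 2 + pi) = -1 :> R by rewrite sinDpi sin_pihalf.
have P t : 0 <= cos t -> is_derive t 1 (Hp \o sin) (G (circle_pt t) * cos t).
  move=> c0; rewrite /circle_pt.
  have -> : G (cos t, sin t) = hp (sin t) by rewrite /hp half_chord_cos ger0_norm.
  exact: (is_derive1_comp (dHp _ (sin_itv t)) (is_derive_sin t)).
have M t : cos t <= 0 -> is_derive t 1 (Hm \o sin) (G (circle_pt t) * cos t).
  move=> c0; rewrite /circle_pt.
  have -> : G (cos t, sin t) = hm (sin t).
    by rewrite /hm half_chord_cos ler0_norm// opprK.
  exact: (is_derive1_comp (dHm _ (sin_itv t)) (is_derive_sin t)).
have dI := Rintegral_itv_derive _ cI.
have pi20 : 0 <= pi / 2 :> R by lra.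
have I1 (t : R) : 0 <= t <= pi / 2 ->
    is_derive t 1 (Hp \o sin) (G (circle_pt t) * cos t).
  by move=> /andP[t0 t1]; apply: P; apply: cos_ge0_pihalf; apply/andP; split; lra.
have I2 (t : R) : pi / 2 <= t <= pi / 2 + pi ->
    is_derive t 1 (Hm \o sin) (G (circle_pt t) * cos t).
  move=> /andP[t0 t1]; apply: M.
  rewrite -[t](subrK pi) cosDpi oppr_le0; apply: cos_ge0_pihalf.
  by apply/andP; split; lra.
have I3 (t : R) : pi / 2 + pi <= t <= 2 * pi ->
    is_derive t 1 (Hp \o sin) (G (circle_pt t) * cos t).
  move=> /andP[t0 t1]; apply: P.
  rewrite -[t](subrK pi) cosDpi -[t - pi](subrK pi) cosDpi opprK.
  by apply: cos_ge0_pihalf; apply/andP; split; lra.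
have le1 : pi / 2 <= pi / 2 + pi :> R by lra.
have le2 : pi / 2 + pi <= 2 * pi :> R by lra.
rewrite (dI _ _ _ pi20 I1) (dI _ _ _ le1 I2) (dI _ _ _ le2 I3).
(* The first and third arcs both involve [Hp 0], which cancels; the increments that remain are those
   of [Hp] from -1 to 1 and of [Hm] from 1 to -1. *)
rewrite /= sin32 sin_pihalf sin0 mulr_natl sin2pi.
lra.
Qed.

(** The same argument on vertical chords. The primitives on the circle are now [- Hp (cos t)] and
    [- Hm (cos t)], since the derivative of cosine is minus sine, and two arcs suffice because the
    sine changes sign only at pi. *)
Lemma green_dy G g : continuous G -> continuous g ->
  (forall p, is_derive p e2 G (g p)) ->
  \int[area]_(p in disk) g p =
  \int[mu]_(t in angles) (G (circle_pt t) * sin t).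
Proof.
move=> cG cg dG.
pose hp x := G (x, half_chord x); pose hm x := G (x, - half_chord x).
have chp : continuous hp.
  exact: (continuous_slice cG continuous_id_fun continuous_half_chord).
have chm : continuous hm.
  exact: (continuous_slice cG continuous_id_fun continuousN_half_chord).
have [Hp dHp] := continuous_primitive chp.
have [Hm dHm] := continuous_primitive chm.
have -> : \int[area]_(p in disk) g p = (Hp 1 - Hm 1) - (Hp (-1) - Hm (-1)).
  rewrite /Rintegral integral_mkcond -(integral12_prod_meas1 (area_disk_restrict cg)).
  have chords := @integral_chords _ Hp Hm hp hm chp chm _ dHp dHm.
  rewrite -[RHS]/(fine (_%:E)) -chords; last first.
    by move=> y /half_chord_eq0 hy; rewrite /hp /hm hy oppr0.
  congr fine; apply: eq_integral => x _.
  have cs := continuous_slice cg (@cst_continuous R R x) continuous_id_fun.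
  rewrite -(integral_chord x cs (fun y => is_derive_slice2 (dG (x, y)))).
  apply: eq_integral => y _; rewrite !patchE; congr (if _ then _ else _).
  by apply/idP/idP; rewrite !inE /disk/= addrC.
have cI : continuous (fun t => G (circle_pt t) * sin t).
  by apply: continuousM_circle => //; exact: continuous_sin.
have pi0 := pi_gt0 R.
rewrite /angles (@Rintegral_itv_cat _ _ 0 pi) ?ltW//; last by lra.
have P t : 0 <= sin t ->
    is_derive t 1 (fun t => - Hp (cos t)) (G (circle_pt t) * sin t).
  move=> c0; rewrite /circle_pt.
  have -> : G (cos t, sin t) = hp (cos t) by rewrite /hp half_chord_sin ger0_norm.
  rewrite -[_ * _]opprK -mulrN.
  exact: (is_deriveN (is_derive1_comp (dHp _ (cos_itv t)) (is_derive_cos t))).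
have M t : sin t <= 0 ->
    is_derive t 1 (fun t => - Hm (cos t)) (G (circle_pt t) * sin t).
  move=> c0; rewrite /circle_pt.
  have -> : G (cos t, sin t) = hm (cos t).
    by rewrite /hm half_chord_sin ler0_norm// opprK.
  rewrite -[_ * _]opprK -mulrN.
  exact: (is_deriveN (is_derive1_comp (dHm _ (cos_itv t)) (is_derive_cos t))).
have dI := Rintegral_itv_derive _ cI.
have I1 (t : R) : 0 <= t <= pi ->
    is_derive t 1 (fun t => - Hp (cos t)) (G (circle_pt t) * sin t).
  by move=> t0; apply: P; exact: sin_ge0_pi.
have I2 (t : R) : pi <= t <= 2 * pi ->
    is_derive t 1 (fun t => - Hm (cos t)) (G (circle_pt t) * sin t).
  move=> /andP[t0 t1]; apply: M.
  rewrite -[t](subrK pi) sinDpi oppr_le0; apply: sin_ge0_pi.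
  by apply/andP; split; lra.
have le1 : pi <= 2 * pi :> R by lra.
rewrite (dI _ _ _ (ltW pi0) I1) (dI _ _ _ le1 I2).
rewrite /= cos0 cospi mulr_natl cos2pi.
lra.
Qed.

End GreenReal.

(** * Complex-valued integrals and the L^2 inner product *)

Notation Re := complex.Re.
Notation Im := complex.Im.

Section ComplexParts.
Context {R : rcfType}.
Implicit Types (x y : R[i]) (a : R).

Lemma ReD x y : Re (x + y) = Re x + Re y. Proof. by case: x; case: y. Qed.
Lemma ImD x y : Im (x + y) = Im x + Im y. Proof. by case: x; case: y. Qed.
Lemma ReN x : Re (- x) = - Re x. Proof. by case: x. Qed.
Lemma ImN x : Im (- x) = - Im x. Proof. by case: x. Qed.
Lemma ReM x y : Re (x * y) = Re x * Re y - Im x * Im y.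
Proof. by case: x; case: y. Qed.
Lemma ImM x y : Im (x * y) = Re x * Im y + Im x * Re y.
Proof. by case: x; case: y. Qed.
Lemma ReJ x : Re (x^*)%R = Re x. Proof. by case: x. Qed.
Lemma ImJ x : Im (x^*)%R = - Im x. Proof. by case: x. Qed.
Lemma complex_ext x y : Re x = Re y -> Im x = Im y -> x = y.
Proof. by case: x y => [a b] [c d] /= -> ->. Qed.

Definition parts := (ReD, ImD, ReN, ImN, ReM, ImM, ReJ, ImJ).

(** With this norm the estimates of the real and of the imaginary part simply add up. *)
Definition norm1 x : R := `|Re x| + `|Im x|.

Lemma norm1_ge0 x : 0 <= norm1 x. Proof. exact: addr_ge0. Qed.

Lemma norm1D x y : norm1 (x + y) <= norm1 x + norm1 y.
Proof. by rewrite /norm1 ReD ImD addrACA lerD ?ler_normD. Qed.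

Lemma norm1_small x : (forall e, 0 < e -> norm1 x <= e) -> x = 0.
Proof.
move=> h; have /eqP : norm1 x = 0.
  by apply/eqP; rewrite eq_le norm1_ge0 andbT; apply/ler_addgt0Pr => e /h; rewrite add0r.
rewrite paddr_eq0// !normr_eq0 => /andP[/eqP a /eqP b].
exact: complex_ext.
Qed.

End ComplexParts.

Section ComplexIntegral.
Context {d : measure_display} {T : measurableType d} {R : realType}.
Variables (mu : {measure set T -> \bar R}) (A : set T).
Hypothesis mA : measurable A.
Implicit Types (f g h : T -> R[i]) (c : R[i]).

(** [Rintegral] sends an infinite integral to 0, so linearity of [cintegral] is proved under this
    condition. *)
Definition cintegrable f :=
  mu.-integrable A (fun x => (Re (f x))%:E) /\
  mu.-integrable A (fun x => (Im (f x))%:E).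

Lemma integrable_lin (a b : R) (u v : T -> R) :
  mu.-integrable A (EFin \o u) -> mu.-integrable A (EFin \o v) ->
  mu.-integrable A (EFin \o (fun x => a * u x + b * v x)).
Proof.
move=> iu iv; have := integrableD mA (integrableZl mA a iu) (integrableZl mA b iv).
by apply: eq_integrable => // x _ /=; rewrite EFinD !EFinM.
Qed.

Lemma Rintegral_lin (a b : R) (u v : T -> R) :
  mu.-integrable A (EFin \o u) -> mu.-integrable A (EFin \o v) ->
  \int[mu]_(x in A) (a * u x + b * v x) =
  a * \int[mu]_(x in A) u x + b * \int[mu]_(x in A) v x.
Proof.
move=> iu iv.
have Z r w : mu.-integrable A (EFin \o w) ->
    mu.-integrable A (EFin \o (fun x => r * w x)).
  by move=> /(integrableZl mA r); apply: eq_integrable.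
by rewrite RintegralD ?RintegralZl//; exact: Z.
Qed.

Lemma eq_cintegral f g : {in A, f =1 g} -> cintegral mu A f = cintegral mu A g.
Proof.
by move=> fg; congr (_ +i* _); apply: eq_Rintegral => x xA; rewrite fg.
Qed.

Lemma eq_cintegrable f g : {in A, f =1 g} -> cintegrable f -> cintegrable g.
Proof.
by move=> fg [i1 i2]; split; [move: i1|move: i2]; apply: eq_integrable => // x xA;
  rewrite fg.
Qed.

Lemma cintegrableZ c f : cintegrable f -> cintegrable (fun x => c * f x).
Proof.
move=> [i1 i2]; split.
  have := integrable_lin (Re c) (- Im c) i1 i2.
  by apply: eq_integrable => // x _ /=; rewrite ReM mulNr.
have := integrable_lin (Re c) (Im c) i2 i1.
by apply: eq_integrable => // x _ /=; rewrite ImM.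
Qed.

Lemma cintegralZ c f : cintegrable f ->
  cintegral mu A (fun x => c * f x) = c * cintegral mu A f.
Proof.
move=> [i1 i2]; apply: complex_ext; rewrite !parts /=.
  rewrite -mulNr -(Rintegral_lin _ _ i1 i2).
  by apply: eq_Rintegral => x _; rewrite ReM mulNr.
rewrite -(Rintegral_lin _ _ i2 i1).
by apply: eq_Rintegral => x _; rewrite ImM.
Qed.

Lemma cintegrableD f g : cintegrable f -> cintegrable g ->
  cintegrable (fun x => f x + g x).
Proof.
move=> [f1 f2] [g1 g2]; split.
  have := integrable_lin 1 1 f1 g1.
  by apply: eq_integrable => // x _ /=; rewrite ReD !mul1r.
have := integrable_lin 1 1 f2 g2.
by apply: eq_integrable => // x _ /=; rewrite ImD !mul1r.
Qed.

Lemma cintegralD f g : cintegrable f -> cintegrable g ->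
  cintegral mu A (fun x => f x + g x) = cintegral mu A f + cintegral mu A g.
Proof.
move=> [f1 f2] [g1 g2]; apply: complex_ext; rewrite !parts /=.
  by rewrite -RintegralD//; apply: eq_Rintegral => x _; rewrite ReD.
by rewrite -RintegralD//; apply: eq_Rintegral => x _; rewrite ImD.
Qed.

Lemma cintegrable0 : cintegrable (fun=> 0).
Proof. by split; exact: (integrable0 mu A). Qed.

Lemma cintegral0 : cintegral mu A (fun=> 0) = 0.
Proof. by rewrite /cintegral !Rintegral_cst//= !mul0r. Qed.

Lemma cintegral_sum (I : Type) (r : seq I) (F : I -> T -> R[i]) :
  (forall i, cintegrable (F i)) ->
  cintegrable (fun x => \sum_(i <- r) F i x) /\
  cintegral mu A (fun x => \sum_(i <- r) F i x) = \sum_(i <- r) cintegral mu A (F i).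
Proof.
move=> iF; elim: r => [|i r [IH1 IH2]].
  split; first by apply: eq_cintegrable cintegrable0 => x _; rewrite big_nil.
  by rewrite [RHS]big_nil -[RHS]cintegral0; apply: eq_cintegral => x _; rewrite big_nil.
split.
  by apply: eq_cintegrable (cintegrableD (iF i) IH1) => x _; rewrite big_cons.
rewrite big_cons -IH2 -cintegralD//.
by apply: eq_cintegral => x _; rewrite big_cons.
Qed.

Lemma cintegral_conj f : cintegrable f ->
  cintegral mu A (fun x => ((f x)^*)%R) = ((cintegral mu A f)^*)%R.
Proof.
move=> [i1 i2]; apply: complex_ext; rewrite !parts /=.
  by apply: eq_Rintegral => x _; rewrite ReJ.
rewrite -mulN1r -RintegralZl//.
by apply: eq_Rintegral => x _; rewrite ImJ mulN1r.
Qed.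

Definition sqmod (z : R[i]) : R := Re z ^+ 2 + Im z ^+ 2.

Lemma sqmod_ge0 z : 0 <= sqmod z. Proof. by rewrite addr_ge0 ?sqr_ge0. Qed.

Lemma cmeasurableM f g : cmeasurable_fun A f -> cmeasurable_fun A g ->
  cmeasurable_fun A (fun x => f x * g x).
Proof.
move=> [f1 f2] [g1 g2]; split.
  under eq_fun do rewrite ReM.
  by apply: measurable_funB; apply: measurable_funM.
under eq_fun do rewrite ImM.
by apply: measurable_funD; apply: measurable_funM.
Qed.

Lemma cmeasurable_conj f : cmeasurable_fun A f ->
  cmeasurable_fun A (fun x => ((f x)^*)%R).
Proof.
move=> [f1 f2]; split; first by under eq_fun do rewrite ReJ.
under eq_fun do rewrite ImJ.
exact: measurableT_comp.
Qed.

Lemma cmeasurableD f g : cmeasurable_fun A f -> cmeasurable_fun A g ->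
  cmeasurable_fun A (fun x => f x + g x).
Proof.
move=> [f1 f2] [g1 g2]; split.
  by under eq_fun do rewrite ReD; exact: measurable_funD.
by under eq_fun do rewrite ImD; exact: measurable_funD.
Qed.

Lemma cmeasurable_cst c : cmeasurable_fun A (fun=> c).
Proof. by split; exact: measurable_cst. Qed.

Lemma measurable_sqmod f : cmeasurable_fun A f ->
  measurable_fun A (fun x => sqmod (f x)).
Proof.
by move=> [f1 f2]; apply: measurable_funD; exact: measurable_funX.
Qed.

Lemma L2P f : L2 mu A f <-> cmeasurable_fun A f /\
  mu.-integrable A (EFin \o (fun x => sqmod (f x))).
Proof.
split=> -[mf Sf]; split => //.
  apply/integrableP; split; first exact/measurable_EFinP/measurable_sqmod.
  apply: le_lt_trans Sf; rewrite le_eqVlt; apply/orP; left; apply/eqP.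
  by apply: eq_integral => x _ /=; rewrite ger0_norm ?sqmod_ge0.
move/integrableP: Sf => [_]; apply: le_lt_trans.
rewrite le_eqVlt; apply/orP; left; apply/eqP.
by apply: eq_integral => x _ /=; rewrite ger0_norm ?sqmod_ge0.
Qed.

Lemma sqnormE f : L2 mu A f ->
  sqnorm mu A f = (\int[mu]_(x in A) sqmod (f x))%:E.
Proof.
move=> /L2P[_ iS]; rewrite /Rintegral fineK//.
exact: integrable_fin_num.
Qed.

Lemma L2_le f (u : T -> R) : cmeasurable_fun A f ->
  mu.-integrable A (EFin \o u) -> (forall x, A x -> sqmod (f x) <= u x) -> L2 mu A f.
Proof.
move=> mf iu h; apply/L2P; split => //; apply: le_integrable iu => //.
  exact/measurable_EFinP/measurable_sqmod.
move=> x Ax /=; rewrite lee_fin ger0_norm ?sqmod_ge0//.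
by rewrite (le_trans (h _ Ax))// ler_norm.
Qed.

Lemma L2D f g : L2 mu A f -> L2 mu A g -> L2 mu A (fun x => f x + g x).
Proof.
move=> /L2P[mf iF] /L2P[mg iG].
(* The dominating function comes from (a + b)^2 <= 2 a^2 + 2 b^2. *)
apply: L2_le (integrable_lin 2 2 iF iG) _; first exact: cmeasurableD.
move=> x _; rewrite /sqmod !parts.
set a := Re _; set b := Re _; set c := Im _; set e := Im _.
have := sqr_ge0 (a - b); have := sqr_ge0 (c - e); lra.
Qed.

Lemma L2Z c f : L2 mu A f -> L2 mu A (fun x => c * f x).
Proof.
move=> /L2P[mf iF].
apply: L2_le (integrable_lin (sqmod c) 0 iF iF) _.
  by apply: cmeasurableM => //; exact: cmeasurable_cst.
move=> x _; rewrite mul0r addr0 /sqmod !parts le_eqVlt; apply/orP; left; apply/eqP.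
ring.
Qed.

Lemma L20 : L2 mu A (fun=> 0).
Proof.
apply: (@L2_le _ (fun=> 0)) => [||x _]; first exact: cmeasurable_cst.
  exact: (integrable0 mu A).
by rewrite /sqmod /= expr0n/= addr0.
Qed.

Lemma L2_sum (I : Type) (r : seq I) (F : I -> T -> R[i]) :
  (forall i, L2 mu A (F i)) -> L2 mu A (fun x => \sum_(i <- r) F i x).
Proof.
move=> LF; elim: r => [|i r IH].
  by under eq_fun do rewrite big_nil; exact: L20.
by under eq_fun do rewrite big_cons; exact: L2D.
Qed.

Lemma L2B f g : L2 mu A f -> L2 mu A g -> L2 mu A (fun x => f x - g x).
Proof.
move=> Lf Lg; under eq_fun do rewrite -mulN1r.
exact/L2D/L2Z.
Qed.

Lemma inner_integrable f g : L2 mu A f -> L2 mu A g ->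
  cintegrable (fun x => f x * (g x)^*).
Proof.
move=> /L2P[mf iF] /L2P[mg iG].
have [m1 m2] := cmeasurableM mf (cmeasurable_conj mg).
have i12 := integrable_lin 1 1 iF iG.
have bound x y z t : `|x * y + z * t| <= x ^+ 2 + z ^+ 2 + (y ^+ 2 + t ^+ 2) :> R.
  rewrite ler_norml; apply/andP; split; have := sqr_ge0 (x - y);
  have := sqr_ge0 (x + y); have := sqr_ge0 (z - t); have := sqr_ge0 (z + t); lra.
split; apply: le_integrable i12 => //; try exact/measurable_EFinP.
all: move=> x _ /=; rewrite lee_fin !mul1r /sqmod !parts.
all: rewrite [leRHS]ger0_norm ?addr_ge0 ?sqr_ge0//.
  by rewrite mulrN opprK; exact: bound.
by rewrite -(sqrrN (Im (g x))) [X in _ <= _ + X]addrC; exact: bound.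
Qed.

End ComplexIntegral.

(** * Sesquilinearity and smallness of the inner product *)

Section InnerProduct.
Context {d : measure_display} {T : measurableType d} {R : realType}.
Variables (mu : {measure set T -> \bar R}) (A : set T).
Hypothesis mA : measurable A.
Implicit Types (f g h : T -> R[i]) (c : R[i]).

(** Expanding (s a + b)^2 / (2 s) >= 0 with both signs of b. The free weight s does the work of the
    Cauchy-Schwarz inequality: it makes the contribution of a fixed function small, at the price of
    a large factor on the other one. *)
Lemma weighted_amgm (s x y z t : R) : 0 < s ->
  `|x * y + z * t| <= s / 2 * (x ^+ 2 + z ^+ 2) + s^-1 / 2 * (y ^+ 2 + t ^+ 2).
Proof.
move=> s0; rewrite ler_norml.
have sq a b : 0 <= s / 2 * a ^+ 2 + s^-1 / 2 * b ^+ 2 + a * b.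
  have -> : s / 2 * a ^+ 2 + s^-1 / 2 * b ^+ 2 + a * b = s^-1 / 2 * (s * a + b) ^+ 2.
    by field; rewrite gt_eqF.
  by rewrite mulr_ge0 ?sqr_ge0// divr_ge0// invr_ge0 ltW.
have h1 := sq x y; have h2 := sq x (- y); have h3 := sq z t; have h4 := sq z (- t).
by rewrite !sqrrN in h2 h4; apply/andP; split; lra.
Qed.

Lemma inner_bound (s : R) f g : 0 < s -> L2 mu A f -> L2 mu A g ->
  norm1 (inner mu A f g) <=
  s * \int[mu]_(x in A) sqmod (f x) + s^-1 * \int[mu]_(x in A) sqmod (g x).
Proof.
move=> s0 Lf Lg; have [i1 i2] := inner_integrable mA Lf Lg.
have [_ iF] := (L2P mu A f).1 Lf; have [_ iG] := (L2P mu A g).1 Lg.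
have half u : mu.-integrable A (EFin \o u) ->
    (forall x, A x -> `|u x| <= s / 2 * sqmod (f x) + s^-1 / 2 * sqmod (g x)) ->
    `|\int[mu]_(x in A) u x| <= s / 2 * \int[mu]_(x in A) sqmod (f x) +
      s^-1 / 2 * \int[mu]_(x in A) sqmod (g x).
  move=> iu h; apply: le_trans (le_normr_Rintegral mA iu) _.
  rewrite -(Rintegral_lin mA _ _ iF iG); apply: le_Rintegral => //.
    exact: integrable_norm.
  exact: integrable_lin.
have hR := half _ i1 _; have hI := half _ i2 _.
rewrite /norm1 /inner /cintegral /=.
apply: le_trans (lerD (hR _) (hI _)) _.
- move=> x _; rewrite !parts mulrN opprK /sqmod; exact: weighted_amgm.
- move=> x _; rewrite !parts /sqmod -(sqrrN (Im (g x))) [X in _ <= _ + _ * X]addrC.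
  exact: weighted_amgm.
by rewrite le_eqVlt; apply/orP; left; apply/eqP; field; rewrite gt_eqF.
Qed.

Lemma inner_small f (e : R) : L2 mu A f -> 0 < e ->
  exists2 r : R, 0 < r & forall g, L2 mu A g -> (sqnorm mu A g < r%:E)%E ->
    norm1 (inner mu A f g) <= e /\ norm1 (inner mu A g f) <= e.
Proof.
move=> Lf e0; set S := \int[mu]_(x in A) sqmod (f x).
have S0 : 0 <= S by apply: Rintegral_ge0 => x _; exact: sqmod_ge0.
(* The weight gives s S <= e / 2, where S + 1 keeps the denominator positive for a null function;
   the threshold s (e / 2) then bounds the other term by e / 2. *)
pose s := e / (2 * (S + 1)).
have S1 : 0 < 2 * (S + 1) by lra.
have s0 : 0 < s by rewrite divr_gt0.
exists (s * (e / 2)); first by rewrite mulr_gt0// divr_gt0.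
move=> g Lg; rewrite (sqnormE mA Lg) lte_fin => gr.
have small : s * S + s^-1 * \int[mu]_(x in A) sqmod (g x) <= e.
  have h1 : s * S <= e / 2.
    rewrite /s mulrAC ler_pdivrMr//.
    have -> : e / 2 * (2 * (S + 1)) = e * S + e by field.
    by rewrite lerDl ltW.
  have h2 : s^-1 * \int[mu]_(x in A) sqmod (g x) <= e / 2.
    by rewrite ler_pdivrMl// ltW.
  by lra.
split; apply: le_trans small; first exact: inner_bound.
(* With the arguments exchanged, the same bound is used with weight [s^-1]. *)
rewrite addrC -{2}(invrK s); apply: inner_bound => //.
by rewrite invr_gt0.
Qed.

Lemma innerD f g h : L2 mu A f -> L2 mu A g -> L2 mu A h ->
  inner mu A (fun x => f x + g x) h = inner mu A f h + inner mu A g h.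
Proof.
move=> Lf Lg Lh; rewrite -cintegralD//; try exact: inner_integrable.
by apply: eq_cintegral => x _; rewrite mulrDl.
Qed.

Lemma innerZ c f g : L2 mu A f -> L2 mu A g ->
  inner mu A (fun x => c * f x) g = c * inner mu A f g.
Proof.
move=> Lf Lg; rewrite -cintegralZ//; last exact: inner_integrable.
by apply: eq_cintegral => x _; rewrite mulrA.
Qed.

Lemma innerB f g h : L2 mu A f -> L2 mu A g -> L2 mu A h ->
  inner mu A (fun x => f x - g x) h = inner mu A f h - inner mu A g h.
Proof.
move=> Lf Lg Lh; rewrite -mulN1r -innerZ// -innerD//; last exact: L2Z.
by apply: eq_cintegral => x _; rewrite mulN1r.
Qed.

Lemma inner_conj f g : L2 mu A f -> L2 mu A g ->
  inner mu A g f = ((inner mu A f g)^*)%R.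
Proof.
move=> Lf Lg; rewrite -cintegral_conj//; last exact: inner_integrable.
by apply: eq_cintegral => x _; apply: complex_ext; rewrite !parts; ring.
Qed.

Lemma innerBr f g h : L2 mu A f -> L2 mu A g -> L2 mu A h ->
  inner mu A h (fun x => f x - g x) = inner mu A h f - inner mu A h g.
Proof.
move=> Lf Lg Lh; rewrite (inner_conj (L2B mA Lf Lg) Lh) innerB// (inner_conj Lf Lh).
by rewrite (inner_conj Lg Lh); apply: complex_ext; rewrite !parts; ring.
Qed.

Lemma inner_sum (I : Type) (r : seq I) (F : I -> T -> R[i]) g :
  (forall i, L2 mu A (F i)) -> L2 mu A g ->
  inner mu A (fun x => \sum_(i <- r) F i x) g = \sum_(i <- r) inner mu A (F i) g.
Proof.
move=> LF Lg; elim: r => [|i r IH].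
  rewrite big_nil -[RHS](cintegral0 mu mA); apply: eq_cintegral => x _.
  by rewrite big_nil mul0r.
rewrite big_cons -IH -innerD//; last exact: L2_sum.
by apply: eq_cintegral => x _; rewrite big_cons.
Qed.

End InnerProduct.

(** * Smooth functions *)

Section Smooth.
Context {R : realType}.
Implicit Types (f g : R * R -> R) (i : 'I_2) (n : nat).
Notation e_ i := (@basis_vec R i).

Lemma Ck_continuous n f : Ck n f -> continuous f.
Proof. by case: n => //= n []. Qed.

Lemma CkS n f : Ck n.+1 f -> Ck n f.
Proof.
elim: n f => [f []//|n IH f [cf df]]; split => // i.
by have [dfi Df] := df i; split => //; exact: IH.
Qed.

(** Introduction rule: [Ck] speaks of the operator ['D], whereas here the partial derivatives may be
    given by a formula. *)
Lemma CkSE n f (df : 'I_2 -> R * R -> R) :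
  continuous f -> (forall i x, is_derive x (e_ i) f (df i x)) ->
  (forall i, Ck n (df i)) -> Ck n.+1 f.
Proof.
move=> cf dfE Cdf; split => // i; split=> [x|]; first by case: (dfE i x).
rewrite (_ : (fun x => _) = df i)//; apply/funext => x.
by case: (dfE i x).
Qed.

Lemma CkS_is_derive n f i x : Ck n.+1 f -> is_derive x (e_ i) f ('D_(e_ i) f x).
Proof. by move=> [_ /(_ i)[dfi _]]; split. Qed.

Lemma Ck_cst n (c : R) : Ck n (fun=> c).
Proof.
elim: n c => [c|n IH c]; first exact: cst_continuous.
have D i (x : R * R) : is_derive x (e_ i) ((fun=> c) : R * R -> R) 0.
  by split; [exact: derivable_cst|exact: derive_cst].
exact: (CkSE (df := fun _ _ => 0) (@cst_continuous _ _ c) D (fun=> IH 0)).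
Qed.

(** The difference quotient is constant on the punctured neighbourhood of 0. *)
Lemma is_derive_linear f (x v : R * R) :
  (forall (h : R) y z, f (h *: z + y) = h * f z + f y) -> is_derive x v f (f v).
Proof.
move=> lf.
have L : h^-1 *: ((f \o shift x) (h *: v) - f x) @[h --> 0^'] --> f v.
  apply: cvg_near_cst; near=> h.
  have h0 : h != 0 by near: h; exact: nbhs_dnbhs_neq.
  by rewrite /= lf addrK /GRing.scale/= mulKf.
by split; [apply/cvg_ex; exists (f v)|apply: cvg_lim].
Unshelve. all: by end_near.
Qed.

Lemma Ck_linear n f : continuous f ->
  (forall (h : R) y z, f (h *: z + y) = h * f z + f y) -> Ck n f.
Proof.
move=> cf lf; case: n => [//|n].
have D i x := is_derive_linear x (e_ i) lf.
exact: (CkSE (df := fun i _ => f (e_ i)) cf D (fun=> Ck_cst _ _)).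
Qed.

Lemma Ck_fst n : Ck n (fun x : R * R => x.1).
Proof. by apply: Ck_linear => // x; exact: cvg_fst. Qed.

Lemma Ck_snd n : Ck n (fun x : R * R => x.2).
Proof. by apply: Ck_linear => // x; exact: cvg_snd. Qed.

Lemma CkD n f g : Ck n f -> Ck n g -> Ck n (fun x => f x + g x).
Proof.
elim: n f g => [f g cf cg x|n IH f g Cf Cg].
  by apply: cvgD; [exact: cf|exact: cg].
have D i x := is_deriveD (CkS_is_derive i x Cf) (CkS_is_derive i x Cg).
apply: (CkSE (df := fun i x => 'D_(e_ i) f x + 'D_(e_ i) g x) _ D) => [x|i].
  by apply: cvgD; [apply: (Ck_continuous Cf)|apply: (Ck_continuous Cg)].
by apply: IH; [case: Cf => _ /(_ i)[]|case: Cg => _ /(_ i)[]].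
Qed.

Lemma CkM n f g : Ck n f -> Ck n g -> Ck n (fun x => f x * g x).
Proof.
elim: n f g => [f g cf cg x|n IH f g Cf Cg].
  by apply: cvgM; [exact: cf|exact: cg].
have D i x := is_deriveM (CkS_is_derive i x Cf) (CkS_is_derive i x Cg).
apply: (CkSE (df := fun i x => f x * 'D_(e_ i) g x + g x * 'D_(e_ i) f x) _ D) => [x|i].
  by apply: cvgM; [apply: (Ck_continuous Cf)|apply: (Ck_continuous Cg)].
by apply: CkD; apply: IH; try exact: CkS; [case: Cg|case: Cf] => _ /(_ i)[].
Qed.

Lemma CkN n f : Ck n f -> Ck n (fun x => - f x).
Proof.
move=> Cf; have := CkM (Ck_cst n (-1)) Cf.
by congr Ck; apply/funext => x; rewrite mulN1r.
Qed.

Definition cCk n (f : R * R -> R[i]) :=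
  Ck n (fun x => Re (f x)) /\ Ck n (fun x => Im (f x)).

Lemma csmoothP (u : R * R -> R[i]) : csmooth u <-> forall n, cCk n u.
Proof. by split=> [[u1 u2] n|h]; split=> // n; case: (h n). Qed.

Implicit Types (u v : R * R -> R[i]).

Lemma cCk_cst n c : cCk n (fun=> c).
Proof. by split; exact: Ck_cst. Qed.

Lemma cCkS n u : cCk n.+1 u -> cCk n u.
Proof. by move=> [u1 u2]; split; exact: CkS. Qed.

Lemma cCkD n u v : cCk n u -> cCk n v -> cCk n (fun x => u x + v x).
Proof.
move=> [u1 u2] [v1 v2]; split.
  by under eq_fun do rewrite ReD; exact: CkD.
by under eq_fun do rewrite ImD; exact: CkD.
Qed.

Lemma cCkM n u v : cCk n u -> cCk n v -> cCk n (fun x => u x * v x).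
Proof.
move=> [u1 u2] [v1 v2]; split.
  by under eq_fun do rewrite ReM; apply/CkD/CkN/CkM => //; exact: CkM.
by under eq_fun do rewrite ImM; apply: CkD; exact: CkM.
Qed.

Lemma cCk_real n f : Ck n f -> cCk n (fun x => (f x)%:C).
Proof. by move=> Cf; split => //; exact: Ck_cst. Qed.

Lemma cCk_conj n u : cCk n u -> cCk n (fun x => ((u x)^*)%R).
Proof.
move=> [u1 u2]; split; first by under eq_fun do rewrite ReJ.
by under eq_fun do rewrite ImJ; exact: CkN.
Qed.

Lemma cCk_partial n i u : cCk n.+1 u -> cCk n (partial i u).
Proof. by move=> [[_ /(_ i)[_ u1]] [_ /(_ i)[_ u2]]]; split. Qed.

Lemma partial_cst i (c : R[i]) x : partial i (fun=> c) x = 0.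
Proof. by rewrite /partial !derive_cst. Qed.

Lemma is_partial i u f g x (a b : R) : (forall y, u y = f y +i* g y) ->
  is_derive x (e_ i) f a -> is_derive x (e_ i) g b -> partial i u x = a +i* b.
Proof.
move=> ufg [_ <-] [_ <-]; rewrite /partial.
have -> : (fun y => Re (u y)) = f by apply/funext => y; rewrite ufg.
by have -> : (fun y => Im (u y)) = g by apply/funext => y; rewrite ufg.
Qed.

Lemma partialM n i u v x : cCk n.+1 u -> cCk n.+1 v ->
  partial i (fun y => u y * v y) x = partial i u x * v x + u x * partial i v x.
Proof.
move=> [u1 u2] [v1 v2].
have D1 := CkS_is_derive i x u1; have D2 := CkS_is_derive i x u2.
have E1 := CkS_is_derive i x v1; have E2 := CkS_is_derive i x v2.
have dR := is_deriveB (is_deriveM D1 E1) (is_deriveM D2 E2).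
have dI := is_deriveD (is_deriveM D1 E2) (is_deriveM D2 E1).
rewrite (is_partial _ dR dI) => [|y]; last by apply: complex_ext; rewrite !parts.
by apply: complex_ext; rewrite !parts /= /GRing.scale/=; ring.
Qed.

Lemma partial_real i f x : partial i (fun y => (f y)%:C) x = ('D_(e_ i) f x)%:C.
Proof. by rewrite /partial /= derive_cst. Qed.

End Smooth.

(** * Moments of the monomials *)

Section Moments.
Context {R : realType}.
Implicit Types (u v : R * R -> R[i]) (s : R) (x : R * R).
Notation mu := (@lebesgue_measure R).

Lemma measurable_angles : measurable (@angles R : set (measurableTypeR R)).
Proof. exact: measurable_itv. Qed.

Lemma continuous_circle (f : R * R -> R) : continuous f ->
  continuous (f \o @circle_pt R).
Proof.
move=> cf.
exact: (continuous_slice cf (@continuous_cos R) (@continuous_sin R)).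
Qed.

Lemma disk_cintegrable u : cCk 0 u -> cintegrable area (@disk R) u.
Proof. by move=> [u1 u2]; split; exact: continuous_integrable_disk. Qed.

Lemma circle_cintegrable u : cCk 0 u -> cintegrable mu (@angles R) (u \o @circle_pt R).
Proof.
by move=> [/continuous_circle u1 /continuous_circle u2]; split;
  exact: continuous_integrable_itv.
Qed.

Lemma continuous_sqmod u : cCk 0 u -> continuous (fun x => sqmod (u x)).
Proof. by move=> [u1 u2]; exact: (@CkD _ 0 _ _ (CkM u1 u1) (CkM u2 u2)). Qed.

Lemma continuous_disk_L2 u : cCk 0 u -> disk_L2 u.
Proof.
move=> Cu; have [u1 u2] := Cu; apply/L2P; split.
  have m1 := continuous_measurable_plane u1.
  have m2 := continuous_measurable_plane u2.
  by split; [exact: (measurable_funS measurableT (@subsetT _ _) m1)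
            |exact: (measurable_funS measurableT (@subsetT _ _) m2)].
exact: (continuous_integrable_disk (continuous_sqmod Cu)).
Qed.

Lemma continuous_circle_L2 u : cCk 0 u -> circle_L2 u.
Proof.
move=> Cu; have [u1 u2] := Cu; apply/L2P; split.
  have m1 := continuous_measurable_fun (continuous_circle u1).
  have m2 := continuous_measurable_fun (continuous_circle u2).
  by split; [exact: (measurable_funS measurableT (@subsetT _ _) m1)
            |exact: (measurable_funS measurableT (@subsetT _ _) m2)].
apply: (@continuous_integrable_itv _ (fun t => sqmod (u (circle_pt t)))).
exact: (continuous_circle (continuous_sqmod Cu)).
Qed.

(** On the unit circle the outward normal is the position vector. *)
Definition normal (i : 'I_2) x : R := if i == ord0 then x.1 else x.2.

Lemma green_real (i : 'I_2) (f : R * R -> R) : Ck 1 f ->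
  \int[area]_(x in disk) 'D_(basis_vec i) f x =
  \int[mu]_(t in angles) (f (circle_pt t) * normal i (circle_pt t)).
Proof.
move=> Cf; have cf := Ck_continuous Cf.
have [_ Df] := Cf; have [_ cDf] := Df i.
have dD x := CkS_is_derive i x Cf.
move: dD cDf; rewrite /basis_vec /normal; case: ifP => _ dD cDf.
  exact: (green_dx cf cDf dD).
exact: (green_dy cf cDf dD).
Qed.

Lemma green (i : 'I_2) u : cCk 1 u ->
  disk_integral (partial i u) = circle_integral (fun x => u x * (normal i x)%:C).
Proof.
move=> [u1 u2]; apply: complex_ext => /=.
  rewrite (green_real _ u1); apply: eq_Rintegral => t _.
  by rewrite /= ReM /= mulr0 subr0.
rewrite (green_real _ u2); apply: eq_Rintegral => t _.
by rewrite /= ImM /= mulr0 add0r.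
Qed.

Definition imag (s : R) : R[i] := 0 +i* s.

Definition w s x : R[i] := x.1 +i* (s * x.2).

Lemma imag_sqr s : s * s = 1 -> imag s * imag s = -1.
Proof. by move=> s1; apply: complex_ext; rewrite !parts /=; lra. Qed.

Lemma wJ s x : ((w s x)^*)%R = w (- s) x.
Proof. by apply: complex_ext; rewrite !parts//= mulNr. Qed.

Lemma wM_circle s t : s * s = 1 -> w s (circle_pt t) * w (- s) (circle_pt t) = 1.
Proof.
move=> s1; apply: complex_ext; rewrite !parts /=; last by ring.
rewrite mulNr mulrN opprK mulrACA s1 mul1r -!expr2; exact: cos2Dsin2.
Qed.

Lemma wE s x : w s x = (x.1)%:C + imag s * (x.2)%:C.
Proof. by apply: complex_ext; rewrite !parts /=; ring. Qed.

Lemma cCk_w n s : cCk n (w s).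
Proof.
split; first exact: Ck_fst.
by apply: CkM; [exact: Ck_cst|exact: Ck_snd].
Qed.

Definition dw s (i : 'I_2) : R[i] := if i == ord0 then 1 else imag s.

Lemma partial_w s i x : partial i (w s) x = dw s i.
Proof.
have D1 := @is_derive_linear _ (fun x => x.1) x (basis_vec i) (fun _ _ _ => erefl).
have D2 := @is_derive_linear _ (fun x => s * x.2) x (basis_vec i).
rewrite (is_partial _ D1 (D2 _)) => // [|h y z /=]; last by rewrite /GRing.scale/=; ring.
by rewrite /dw /basis_vec; case: ifP => _ /=; rewrite ?mulr0 ?mulr1.
Qed.

Lemma cCkX n u k : cCk n u -> cCk n (fun x => u x ^+ k).
Proof.
move=> Cu; elim: k => [|k IH]; first exact: cCk_cst.
by under eq_fun do rewrite exprS; exact: cCkM.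
Qed.

(** At n = 0 the truncated exponent [n.-1] is harmless, as the factor [n%:R] vanishes. *)
Lemma partial_wX s i n x :
  partial i (fun y => w s y ^+ n) x = n%:R * w s x ^+ n.-1 * dw s i.
Proof.
elim: n => [|n IH]; first by rewrite partial_cst !mul0r.
under eq_fun do rewrite exprS.
rewrite (partialM _ _ (cCk_w 1 s) (cCkX n (cCk_w 1 s))) IH partial_w.
case: n {IH} => [|n] /=; first by rewrite !expr0; ring.
by rewrite [n.+2%:R]mulrSr !exprS; ring.
Qed.

Definition mono s (a b : nat) x : R[i] := w s x ^+ a * w (- s) x ^+ b.

Lemma cCk_mono n s a b : cCk n (mono s a b).
Proof. by apply: cCkM; apply: cCkX; exact: cCk_w. Qed.

Lemma mono_swap s a b x : mono s a b x = mono (- s) b a x.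
Proof. by rewrite /mono opprK mulrC. Qed.

Lemma mono_conj s a b x : ((mono s a b x)^*)%R = mono s b a x.
Proof. by rewrite /mono rmorphM !rmorphXn /= !wJ opprK mulrC. Qed.

Lemma monoM s a b c d x : mono s a b x * mono s c d x = mono s (a + c) (b + d) x.
Proof. by rewrite /mono !exprD; ring. Qed.

(* For [s = 1], twice the Wirtinger derivative with respect to conj z. *)
Definition dbar s u x : R[i] := partial ord0 u x + imag s * partial ord_max u x.

(** The two components of the normal, weighted by 1 and [imag s], combine to [w s]. *)
Lemma green_dbar s u : cCk 1 u ->
  disk_integral (dbar s u) = circle_integral (fun x => u x * w s x).
Proof.
move=> Cu; have C1 := cCk_partial ord0 Cu; have C2 := cCk_partial ord_max Cu.
have mD := @measurable_disk R.
rewrite /disk_integral cintegralD//; try exact: disk_cintegrable; last first.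
  by apply: cintegrableZ => //; exact: disk_cintegrable.
rewrite cintegralZ//; last exact: disk_cintegrable.
have Cn i : cCk 0 (fun x => u x * (normal i x)%:C).
  apply: cCkM; first exact: cCkS.
  apply: cCk_real; rewrite /normal; case: (i == ord0).
    exact: (Ck_fst 0).
  exact: (Ck_snd 0).
have := green ord0 Cu; have := green ord_max Cu; rewrite /disk_integral => -> ->.
have mA := measurable_angles.
rewrite /circle_integral -cintegralZ//; last exact: circle_cintegrable.
rewrite -cintegralD//; try exact: circle_cintegrable; last first.
  by apply: cintegrableZ => //; exact: circle_cintegrable.
by apply: eq_cintegral => t _ /=; rewrite wE /normal /=; ring.
Qed.

(** The operator kills [w s] because 1 + ([imag s])^2 = 0, and sends [w (- s)] to 1 - ([imag s])^2 =
    2; the rest is the product rule. *)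
Lemma dbar_mono s a b x : s * s = 1 ->
  dbar s (mono s a b) x = (2 * b%:R) * mono s a b.-1 x.
Proof.
move=> s1; have CX s' n := cCkX n (cCk_w 1 s').
rewrite /dbar !(partialM _ _ (CX s a) (CX (- s) b)) !partial_wX /dw /= /mono.
have -> : imag (- s) = - imag s by apply: complex_ext; rewrite ?ReN ?ImN //= oppr0.
have := imag_sqr s1; set j := imag s => j1.
set A := _ * _ ^+ a.-1; set B := _ ^+ b; set C := _ ^+ a; set D := _ ^+ b.-1.
transitivity (A * B * (1 + j * j) + b%:R * (C * D) * (1 - j * j)); first by ring.
by rewrite j1; ring.
Qed.

Lemma circle_mono_diag s t a : s * s = 1 -> mono s a a (circle_pt t) = 1.
Proof. by move=> s1; rewrite /mono -exprMn wM_circle// expr1n. Qed.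

(** One factor [w s] is the one supplied by Green's theorem, and [dbar s] annihilates the remaining
    power. *)
Lemma circle_w s n : s * s = 1 -> circle_integral (fun x => w s x ^+ n.+1) = 0.
Proof.
move=> s1; transitivity (circle_integral (fun x => mono s n 0 x * w s x)).
  by apply: eq_cintegral => t _ /=; rewrite /mono expr0 mulr1 exprSr.
rewrite -green_dbar; last exact: cCk_mono.
rewrite -[RHS](cintegral0 area (@measurable_disk R)).
by apply: eq_cintegral => x _; rewrite dbar_mono// mulr0 mul0r.
Qed.

(** On the circle [w s] and [w (- s)] are inverse to each other, so only the power a - b of [w s]
    survives; the case a < b follows by exchanging s and - s. *)
Lemma circle_integral_mono s a b : s * s = 1 ->
  circle_integral (mono s a b) = if a == b then (2 * pi)%:C else 0.
Proof.
wlog ab : s a b / (b <= a)%N.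
  move=> H s1; have [|/ltnW ab] := leqP b a; first by move=> /H; apply.
  rewrite eq_sym -(H (- s)) ?mulrNN//.
  by apply: eq_cintegral => t _ /=; exact: mono_swap.
move=> s1; have [->|ne] := eqVneq a b.
  transitivity (circle_integral (fun _ : R * R => 1)).
    by apply: eq_cintegral => t _ /=; rewrite circle_mono_diag.
  rewrite /circle_integral /cintegral /= !Rintegral_cst ?mul1r ?mul0r//;
    try exact: measurable_angles.
  have len : mu (@angles R) = (2 * pi)%:E :> \bar R.
    rewrite /angles (@lebesgue_measure_itv R `[0%R, (2 * pi)%R]) /= lte_fin.
    by rewrite mulr_gt0 ?pi_gt0//= oppr0 adde0.
  by congr (_ +i* _); exact: (congr1 fine len).
have [n En] : exists n, a = (b + n.+1)%N.
  by exists (a - b).-1; rewrite prednK ?subn_gt0 ?subnKC// ltn_neqAle eq_sym ne.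
rewrite -(circle_w n s1); apply: eq_cintegral => t _ /=.
by rewrite En /mono addnC exprD -mulrA -/(mono s b b _) circle_mono_diag ?mulr1.
Qed.

Lemma disk_integral_mono s a b : s * s = 1 ->
  disk_integral (mono s a b) = if a == b then (pi / b.+1%:R)%:C else 0.
Proof.
move=> s1.
(* On the circle the additional factor [w (- s)] cancels the factor [w s] of Green's theorem.
   Dividing 2 pi by the factor 2 (b + 1) from [dbar_mono] gives the value. *)
have : disk_integral (dbar s (mono s a b.+1)) = circle_integral (mono s a b).
  rewrite green_dbar; last exact: cCk_mono.
  apply: eq_cintegral => t _ /=; rewrite /mono exprSr mulrA -[RHS]mulr1.
  by rewrite -(wM_circle t s1); ring.
rewrite circle_integral_mono//.
have -> : disk_integral (dbar s (mono s a b.+1)) =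
    2 * b.+1%:R * disk_integral (mono s a b).
  rewrite /disk_integral -cintegralZ//.
  - by apply: eq_cintegral => x _; exact: dbar_mono.
  - exact: measurable_disk.
  - by apply: disk_cintegrable; exact: cCk_mono.
have nz : 2 * b.+1%:R != 0 :> R[i] by rewrite mulf_neq0 ?pnatr_eq0.
case: ifP => _ E; apply: (mulfI nz); rewrite E ?mulr0//.
rewrite -[b.+1%:R in RHS](rmorph_nat (real_complex R)).
rewrite -[2 in RHS](rmorph_nat (real_complex R)) -!rmorphM.
by congr (_%:C); field; rewrite -mulrS pnatr_eq0.
Qed.

End Moments.

(** * The Neumann problem *)

Section Neumann.
Context {R : realType}.
Implicit Types (u v phi : R * R -> R[i]) (s : R) (x : R * R).
Notation mu := (@lebesgue_measure R).

Lemma partial_conj n i u x : cCk n.+1 u ->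
  partial i (fun y => ((u y)^*)%R) x = ((partial i u x)^*)%R.
Proof.
move=> [u1 u2]; have D1 := CkS_is_derive i x u1.
have D2 := is_deriveN (CkS_is_derive i x u2).
rewrite (is_partial _ D1 D2) => [|y]; last by apply: complex_ext; rewrite !parts.
by apply: complex_ext; rewrite !parts.
Qed.

Lemma partialZ n i c u x : cCk n.+1 u ->
  partial i (fun y => c * u y) x = c * partial i u x.
Proof.
by move=> Cu; rewrite (partialM _ _ (cCk_cst n.+1 c) Cu) partial_cst mul0r add0r.
Qed.

Lemma circle_not_disk (t : R) : ~ disk (circle_pt t).
Proof. by rewrite /disk /circle_pt /= cos2Dsin2 ltxx. Qed.

(** Green's theorem for the product of u and the test function, which vanishes on the circle because
    its support lies in the open disk. *)
Lemma smooth_weak_partial i u : csmooth u -> weak_partial i u (partial i u).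
Proof.
move=> /csmoothP Cu phi [Sphi [K [_ KD phi0]]].
have Cphi n : cCk n (fun x => (phi x)%:C) := cCk_real (Sphi n).
have CuD := cCkM (cCk_partial i (Cu 1)) (Cphi 0).
have CDu := cCkM (Cu 0) (cCk_partial i (Cphi 1)).
have mD := @measurable_disk R.
have : disk_integral (partial i (fun x => u x * (phi x)%:C)) = 0.
  rewrite green; last by apply: cCkM; [exact: Cu|exact: Cphi].
  rewrite -[RHS](cintegral0 mu (@measurable_angles R)).
  apply: eq_cintegral => t _ /=; rewrite phi0 ?mulr0 ?mul0r//.
  by move/KD; exact: circle_not_disk.
have -> : partial i (fun x => u x * (phi x)%:C) =
    (fun x => partial i u x * (phi x)%:C + u x * partial i (fun y => (phi y)%:C) x).
  by apply/funext => x; rewrite (partialM _ _ (Cu 1) (Cphi 1)).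
rewrite /disk_integral cintegralD//; try exact: disk_cintegrable.
move/eqP; rewrite addrC addr_eq0 => /eqP <-.
by apply: eq_cintegral => x _; rewrite partial_real.
Qed.

Definition smooth_H1 u (Su : csmooth u) : H1 :=
  let Cu := (csmoothP u).1 Su in
  @MkH1 R u (fun i => partial i u) (continuous_disk_L2 (Cu 0))
    (fun i => continuous_disk_L2 (cCk_partial i (Cu 1)))
    (fun i => smooth_weak_partial i Su).

Lemma sqnorm_diag d (T : measurableType d) (nu : {measure set T -> \bar R})
    (A : set T) (f : T -> R[i]) : sqnorm nu A (fun y => f y - f y) = 0%E.
Proof.
apply: integral0_eq => x _; rewrite subrr /= expr0n/= addr0//.
Qed.

Lemma smooth_trace u (Su : csmooth u) : is_trace (smooth_H1 Su) u.
Proof.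
have Cu := (csmoothP u).1 Su; split; first exact: continuous_circle_L2.
exists (fun=> u); split=> // [|i|].
- by rewrite /disk_sqnorm sqnorm_diag; exact: cvg_cst.
- by rewrite /disk_sqnorm sqnorm_diag; exact: cvg_cst.
- by rewrite /circle_sqnorm sqnorm_diag; exact: cvg_cst.
Qed.

Lemma cvg0_lt (a : nat -> \bar R) (r : R) : a n @[n --> \oo] --> 0%E -> 0 < r ->
  \forall n \near \oo, (a n < r%:E)%E.
Proof.
move=> a0 r0; have := @open_ereal_lt' R 0%E r%:E; rewrite lte_fin => /(_ r0).
exact: (a0 [set y | (y < r%:E)%E]).
Qed.

Lemma sum_I2 (V : nmodType) (F : 'I_2 -> V) :
  \sum_(i < 2) F i = F ord0 + F ord_max.
Proof.
rewrite big_ord_recl big_ord_recl big_ord0 addr0.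
by rewrite (_ : lift ord0 ord0 = ord_max)//; exact: val_inj.
Qed.

Lemma norm1_three (a0 a1 b0 b1 c z : R[i]) (e : R) : b0 + b1 = c ->
  norm1 (b0 - a0) <= e / 3 -> norm1 (b1 - a1) <= e / 3 -> norm1 (c - z) <= e / 3 ->
  norm1 (a0 + a1 - z) <= e.
Proof.
move=> <- h0 h1 h2.
have normN (y : R[i]) : norm1 (- y) = norm1 y by rewrite /norm1 ReN ImN !normrN.
rewrite (_ : a0 + a1 - z = - (b0 - a0) + - (b1 - a1) + (b0 + b1 - z)); last by ring.
rewrite (le_trans (norm1D _ _))// (_ : e = e / 3 + e / 3 + e / 3); last by field.
by rewrite lerD// (le_trans (norm1D _ _))// !normN lerD.
Qed.

(** Both sides of the weak equation are continuous in the test function for the convergences listed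
    in [is_trace]: gradients in L^2 of the disk, boundary values in L^2 of the circle. Hence smooth
    test functions suffice. *)
Lemma neumann_solutionP f u (Su : csmooth u) : circle_L2 f ->
  (forall phi, csmooth phi ->
     disk_integral (fun x => \sum_(i < 2) partial i u x * ((partial i phi x)^*)%R) =
     circle_inner f phi) ->
  circle_integral u = 0 -> neumann_solution f (smooth_H1 Su).
Proof.
move=> Lf H u0; split; last by exists u => //; exact: smooth_trace.
move=> v h [Lh [phi [Sphi _ gphi hphi]]].
have mD := @measurable_disk R; have mA := @measurable_angles R.
have Cu := (csmoothP u).1 Su; have Cphi n := (csmoothP (phi n)).1 (Sphi n).
have Lu i : disk_L2 (partial i u).
  by apply: continuous_disk_L2; exact: cCk_partial (Cu 1%N).
have Lphi n i : disk_L2 (partial i (phi n)).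
  by apply: continuous_disk_L2; exact: cCk_partial (Cphi n 1%N).
have sumE (g : 'I_2 -> R * R -> R[i]) : (forall i, disk_L2 (g i)) ->
    disk_integral (fun x => \sum_(i < 2) partial i u x * ((g i x)^*)%R) =
    inner area disk (partial ord0 u) (g ord0) +
    inner area disk (partial ord_max u) (g ord_max).
  move=> Lg; have iF i := inner_integrable mD (Lu i) (Lg i).
  have [_ E] := cintegral_sum mD (index_enum 'I_2) iF.
  exact: (etrans E (sum_I2 (fun i => inner area disk (partial i u) (g i)))).
apply/eqP; rewrite -subr_eq0; apply/eqP/norm1_small => e e0.
have e3 : 0 < e / 3 by rewrite divr_gt0.
have [r0 r0gt H0] := inner_small mD (Lu ord0) e3.
have [r1 r1gt H1] := inner_small mD (Lu ord_max) e3.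
have [r2 r2gt H2] := inner_small mA Lf e3.
near \oo => n.
have N0 : (disk_sqnorm (fun x => partial ord0 (phi n) x - grad v ord0 x)%R < r0%:E)%E.
  by near: n; exact: cvg0_lt (gphi ord0) r0gt.
have N1 : (disk_sqnorm (fun x => partial ord_max (phi n) x - grad v ord_max x)%R
    < r1%:E)%E.
  by near: n; exact: cvg0_lt (gphi ord_max) r1gt.
have N2 : (circle_sqnorm (fun x => phi n x - h x)%R < r2%:E)%E.
  by near: n; exact: cvg0_lt hphi r2gt.
have Lv i := grad_L2 v i.
have Lphic : circle_L2 (phi n) by exact: continuous_circle_L2.
have [{}H0 _] := H0 _ (L2B mD (Lphi n ord0) (Lv ord0)) N0.
have [{}H1 _] := H1 _ (L2B mD (Lphi n ord_max) (Lv ord_max)) N1.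
have [{}H2 _] := H2 _ (L2B mA Lphic Lh) N2.
have EL : disk_integral (grad_dot (smooth_H1 Su) v) = _ := sumE _ Lv.
have EH := etrans (esym (sumE _ (Lphi n))) (H (phi n) (Sphi n)).
rewrite (innerBr mD (Lphi n ord0) (Lv ord0) (Lu ord0)) in H0.
rewrite (innerBr mD (Lphi n ord_max) (Lv ord_max) (Lu ord_max)) in H1.
rewrite (innerBr mA Lphic Lh Lf) in H2; rewrite EL.
exact: (norm1_three EH H0 H1 H2).
Unshelve. all: by end_near.
Qed.

Definition kappa : R := (Num.sqrt (2 * pi))^-1.

(** The index is shifted by one, so that frequency 0 never occurs and the gradient carries the
    exponent n. *)
Definition potential s (n : nat) x : R[i] :=
  (kappa / n.+1%:R)%:C * w s x ^+ n.+1.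

Lemma csmooth_potential s n : csmooth (potential s n).
Proof.
by apply/csmoothP => m; apply: cCkM; [exact: cCk_cst|apply: cCkX; exact: cCk_w].
Qed.

Lemma partial_potential i s n x :
  partial i (potential s n) x = kappa%:C * w s x ^+ n * dw s i.
Proof.
rewrite (partialZ _ _ _ (cCkX n.+1 (cCk_w 1 s))) partial_wX /= !mulrA.
congr (_ * _ * _); rewrite -(rmorph_nat (real_complex R)) -rmorphM.
by rewrite divfK// pnatr_eq0.
Qed.

(** Since [dbar s] annihilates powers of [w s], the gradient pairing with a smooth phi equals
    [dbar s] of kappa [w s ^ n] times the conjugate of phi. Green's theorem adds the factor [w s]
    and produces the datum f on the circle. *)
Lemma potential_neumann f s n : s * s = 1 -> circle_L2 f ->
  (forall t, f (circle_pt t) = kappa%:C * w s (circle_pt t) ^+ n.+1) ->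
  neumann_solution f (smooth_H1 (csmooth_potential s n)).
Proof.
move=> s1 Lf fE; apply: neumann_solutionP => //; last first.
  have := circle_w n s1; rewrite /circle_integral => w0.
  rewrite [LHS](cintegralZ (@measurable_angles R)) ?w0 ?mulr0//.
  apply: (@circle_cintegrable _ (fun x => w s x ^+ n.+1)).
  by apply: cCkX; exact: cCk_w.
move=> phi /csmoothP Cphi.
pose psi x := ((phi x)^*)%R.
have Cpsi m : cCk m psi := cCk_conj (Cphi m).
have Cw m : cCk m (fun x => kappa%:C * w s x ^+ n).
  by apply: cCkM; [exact: cCk_cst|apply: cCkX; exact: cCk_w].
transitivity (disk_integral (dbar s (fun x => kappa%:C * w s x ^+ n * psi x))).
  apply: eq_cintegral => x _.
  rewrite sum_I2 /dbar.
  rewrite !(partialM _ _ (Cw 1) (Cpsi 1)) !partial_potential.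
  rewrite !(partialZ _ _ _ (cCkX n (cCk_w 1 s))) !partial_wX.
  rewrite !(partial_conj _ _ (Cphi 1)) /dw /=.
  set D0 := (partial ord0 phi x)^*%R; set D1 := (partial ord_max phi x)^*%R.
  have := imag_sqr s1; set j := imag s => j1.
  set W := _ ^+ n; set W' := _ ^+ n.-1.
  transitivity (kappa%:C * W * (D0 + j * D1) +
    kappa%:C * n%:R * W' * (1 + j * j) * psi x); last by ring.
  by rewrite j1; ring.
rewrite green_dbar; last by apply: cCkM; [exact: Cw|exact: Cpsi].
apply: eq_cintegral => t _ /=; rewrite fE /psi exprSr; ring.
Qed.

End Neumann.

(** * Radial moments of the Zernike polynomials *)

Section RadialMoments.
Context {F : realFieldType}.
Implicit Types (f : nat -> F) (x y z : F).

(** Up to the sign (-1)^q, the q-th finite difference of f at 0. *)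
Definition alt_sum (q : nat) f : F :=
  \sum_(s < q.+1) (-1) ^+ s * 'C(q, s)%:R * f s.

(** The falling factorial as a polynomial, which, unlike [_ ^_ _], can be evaluated at the negative
    number n - x of [zernike_radial_moment]. *)
Definition falling (d : nat) z : F := \prod_(i < d) (z - i%:R).

Lemma fallingS d z : falling d.+1 z = z * falling d (z - 1).
Proof.
rewrite /falling big_ord_recl subr0; congr (_ * _); apply: eq_bigr => i _.
by rewrite /= -[bump 0 i]/(i.+1) mulrS opprD addrA.
Qed.

Lemma fallingSr d z : falling d.+1 z = falling d z * (z - d%:R).
Proof. by rewrite /falling big_ord_recr. Qed.

Lemma falling_nat d n : falling d n%:R = (n ^_ d)%:R.
Proof.
elim: d n => [|d IH] n; first by rewrite /falling big_ord0.
rewrite fallingS ffactnS; case: n => [|n]; first by rewrite !mul0r.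
by rewrite -natr1 addrK IH natr1 natrM.
Qed.

Lemma fallingN d z : falling d (- z) = (-1) ^+ d * falling d (z + d%:R - 1).
Proof.
elim: d z => [|d IH] z; first by rewrite /falling !big_ord0 mulr1.
rewrite fallingS -opprD IH fallingS exprS -natr1.
have -> : z + (d%:R + 1) - 1 = z + d%:R by ring.
have -> : z + 1 + d%:R - 1 = z + d%:R by ring.
by rewrite -fallingS fallingSr; ring.
Qed.

Lemma eq_alt_sum q f g : f =1 g -> alt_sum q f = alt_sum q g.
Proof. by move=> fg; apply: eq_bigr => s _; rewrite fg. Qed.

Lemma alt_sum_lin q f g x y :
  alt_sum q (fun s => x * f s + y * g s) = x * alt_sum q f + y * alt_sum q g.
Proof.
by rewrite /alt_sum !mulr_sumr -big_split; apply: eq_bigr => s _ /=; ring.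
Qed.

(** Pascal's rule. *)
Lemma alt_sumS q f : alt_sum q.+1 f = alt_sum q f - alt_sum q (fun s => f s.+1).
Proof.
rewrite /alt_sum big_ord_recl [X in _ = X - _]big_ord_recl !bin0 -addrA.
congr (_ + _); rewrite [X in _ = X - _](_ : _ =
    \sum_(s < q.+1) (-1) ^+ s.+1 * 'C(q, s.+1)%:R * f s.+1); last first.
  by rewrite [RHS]big_ord_recr /= bin_small// mulr0 mul0r addr0.
rewrite -sumrB; apply: eq_bigr => s _.
by rewrite /= -[bump 0 s]/(s.+1) binS natrD exprS; ring.
Qed.

(** Finite differences lower the degree: one difference step turns [falling d.+1] into d + 1 times
    [falling d], and constants are killed. *)
Lemma alt_sum_falling q d y : (d < q)%N ->
  alt_sum q (fun s => falling d (y - s%:R)) = 0.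
Proof.
elim: q d y => [//|q IH] [|d] y dq; rewrite alt_sumS.
  rewrite (_ : (fun s => _) = (fun s => falling 0 (y - s.+1%:R))) ?subrr//.
  by apply/funext => s; rewrite /falling !big_ord0.
have E s : falling d.+1 (y - s%:R) =
    1 * falling d.+1 (y - s.+1%:R) + d.+1%:R * falling d (y - 1 - s%:R).
  have -> : y - s.+1%:R = y - 1 - s%:R by rewrite -natr1; ring.
  by rewrite fallingS fallingSr -natr1 addrAC; ring.
by rewrite (eq_alt_sum q E) alt_sum_lin IH// mulr0 addr0 mul1r subrr.
Qed.

(** This is the partial fraction decomposition of 1 / (x (x - 1) ... (x - q)), read from right to
    left. *)
Lemma alt_sum_inv q x : (forall i : nat, (i <= q)%N -> x - i%:R != 0) ->
  alt_sum q (fun s => (x - s%:R)^-1) = (-1) ^+ q * q`!%:R / falling q.+1 x.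
Proof.
elim: q x => [|q IH] x x0.
  by rewrite /alt_sum /falling !big_ord1 bin0 !mul1r.
rewrite alt_sumS IH => [|i iq]; last by apply: x0; rewrite leqW.
have -> : alt_sum q (fun s => (x - s.+1%:R)^-1) =
    alt_sum q (fun s => (x - 1 - s%:R)^-1).
  by apply: eq_alt_sum => s; congr (_^-1); rewrite -natr1; ring.
rewrite IH => [|i iq]; last first.
  by have := x0 i.+1 iq; rewrite -natr1 opprD addrA addrAC.
rewrite [falling q.+1 x]fallingS [falling q.+2 x]fallingS.
rewrite [falling q.+1 (x - 1)]fallingSr factS natrM exprS.
have := x0 0 isT; rewrite subr0 => nx.
have nq : x - 1 - q%:R != 0.
  by have := x0 q.+1 (leqnn _); rewrite -natr1 opprD addrA addrAC.
have nf : falling q (x - 1) != 0.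
  apply/prodf_neq0 => i _; have := x0 i.+1 (leqW (ltn_ord i)).
  by rewrite -natr1 opprD addrA addrAC.
move: (falling _ _) nf => f nf; rewrite -natr1; field.
by rewrite nf nx nq.
Qed.

(* Replace [y - d - s] by [(y - d - x) + (x - s)]: the second term cancels the
   denominator and leaves an alternating sum of a polynomial of degree d < q. *)
Lemma alt_sum_falling_inv q d x y : (d <= q)%N ->
  (forall i : nat, (i <= q)%N -> x - i%:R != 0) ->
  alt_sum q (fun s => falling d (y - s%:R) / (x - s%:R)) =
  falling d (y - x) * alt_sum q (fun s => (x - s%:R)^-1).
Proof.
move=> + x0; elim: d => [|d IH] dq.
  by rewrite {2}/falling big_ord0 mul1r; apply: eq_alt_sum => s;
    rewrite /falling big_ord0 mul1r.
transitivity (alt_sum q (fun s => (y - x - d%:R) * (falling d (y - s%:R) / (x - s%:R))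
    + 1 * falling d (y - s%:R))).
  apply: eq_bigr => s _; congr (_ * _); rewrite fallingSr.
  by field; apply: x0; rewrite -ltnS.
rewrite (alt_sum_lin q (fun s => falling d (y - s%:R) / (x - s%:R))).
rewrite (alt_sum_falling y dq) mulr0 addr0 (IH (ltnW dq)) fallingSr mulrA.
by congr (_ * _); exact: mulrC.
Qed.

(** Multiplied by s! (q - s)! (n - s - q)!, both sides become q! (n - s)!. The identity exhibits the
    Zernike coefficients as the weights of [alt_sum] times a polynomial of degree q in s. *)
Lemma zernike_coef_bin (n q s : nat) : (s <= q)%N -> (2 * q <= n)%N ->
  ('C(n - s, s) * 'C(n - 2 * s, q - s) * q`! = 'C(q, s) * (n - s) ^_ q)%N.
Proof.
move=> sq qn.
have h1 : ('C(n - s, s) * (s`! * (n - 2 * s)`!) = (n - s)`!)%N.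
  by rewrite -(@bin_fact (n - s) s) ?mul2n -?addnn ?subnDA//; lia.
have h2 : ('C(n - 2 * s, q - s) * ((q - s)`! * (n - s - q)`!) = (n - 2 * s)`!)%N.
  rewrite -(@bin_fact (n - 2 * s) (q - s)); last by lia.
  by congr (_ * (_ * _`!))%N; lia.
have h3 : ('C(q, s) * (s`! * (q - s)`!) = q`!)%N by rewrite bin_fact.
have h4 : ((n - s) ^_ q * (n - s - q)`! = (n - s)`!)%N.
  by rewrite ffact_fact//; lia.
apply/eqP; rewrite -(@eqn_pmul2r (s`! * (q - s)`! * (n - s - q)`!)) ?muln_gt0 ?fact_gt0//.
apply/eqP.
transitivity (q`! * ('C(n - s, s) * (s`! *
    ('C(n - 2 * s, q - s) * ((q - s)`! * (n - s - q)`!)))))%N.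
  by ring.
rewrite h2 h1.
transitivity (('C(q, s) * (s`! * (q - s)`!)) * ((n - s) ^_ q * (n - s - q)`!))%N.
  by rewrite h3 h4.
by ring.
Qed.

(** The sum is twice the integral over [0, 1] of the q-th radial polynomial against r^(m + 2 k + 1).
    The pole is at x = m + k + q + 1, and n - x = -(k + 1 - q), so the reflection [fallingN] yields
    the falling factorial of k with a sign that cancels the one of [alt_sum_inv]. *)
Lemma zernike_radial_moment (m k q : nat) :
  \sum_(0 <= s < q.+1) (-1) ^+ s * 'C(m + 2 * q - s, s)%:R *
    'C(m + 2 * q - 2 * s, q - s)%:R / (m + k + q - s).+1%:R =
  (k ^_ q)%:R / ((m + k + q).+1 ^_ q.+1)%:R :> F.
Proof.
set n := (m + 2 * q)%N; set x : F := (m + k + q).+1%:R.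
have qf : q`!%:R != 0 :> F by rewrite pnatr_eq0 -lt0n fact_gt0.
have x0 (i : nat) : (i <= q)%N -> x - i%:R != 0.
  by move=> iq; rewrite -natrB ?pnatr_eq0; lia.
have E (s : nat) : (s <= q)%N -> 'C(n - s, s)%:R * 'C(n - 2 * s, q - s)%:R =
    'C(q, s)%:R * falling q (n%:R - s%:R) / q`!%:R :> F.
  move=> sq; rewrite -natrB; last by rewrite /n; lia.
  rewrite falling_nat -!natrM -zernike_coef_bin//; last by rewrite /n; lia.
  by rewrite !natrM mulfK.
transitivity (alt_sum q (fun s => falling q (n%:R - s%:R) / (x - s%:R)) / q`!%:R).
  rewrite big_mkord /alt_sum mulr_suml; apply: eq_bigr => s _.
  have sq : (s <= q)%N by rewrite -ltnS.
  rewrite -[_ * _ * 'C(n - 2 * s, _)%:R]mulrA E//.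
  have -> : (m + k + q - s).+1%:R = x - s%:R by rewrite -natrB; [congr _%:R|]; lia.
  by rewrite -!mulrA; congr (_ * (_ * (_ * _))); rewrite mulrC.
rewrite alt_sum_falling_inv// alt_sum_inv//.
have -> : n%:R - x = - (k.+1%:R - q%:R).
  have -> : n%:R = m%:R + 2 * q%:R :> F by rewrite /n natrD natrM.
  have -> : x = m%:R + k%:R + q%:R + 1 by rewrite /x -natr1 !natrD.
  by rewrite -natr1; ring.
rewrite fallingN (_ : k.+1%:R - q%:R + q%:R - 1 = k%:R); last by rewrite -natr1; ring.
rewrite /x !falling_nat mulrACA -signr_odd; case: odd => /=.
  all: field; rewrite qf andbT pnatr_eq0 -lt0n ffact_gt0; lia.
Qed.

(** Multiplied by (k - q)! (m + k)!, both sides become (m + k + q + 1) (m + 2 k)!. *)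
Lemma bin_ffact_shift (m k q : nat) : (q <= k)%N ->
  ('C(m + 2 * k, k) * k ^_ q * (m + k + q).+1 =
   'C(m + 2 * k, k - q) * (m + k + q).+1 ^_ q.+1)%N.
Proof.
move=> qk; rewrite ffactnS /=.
have h1 : ('C(m + 2 * k, k) * (k`! * (m + k)`!) = (m + 2 * k)`!)%N.
  rewrite -(@bin_fact (m + 2 * k) k); last by lia.
  by congr (_ * (_ * _`!))%N; lia.
have h2 : (k ^_ q * (k - q)`! = k`!)%N by rewrite ffact_fact.
have h3 : ('C(m + 2 * k, k - q) * ((k - q)`! * (m + k + q)`!) = (m + 2 * k)`!)%N.
  rewrite -(@bin_fact (m + 2 * k) (k - q)); last by lia.
  by congr (_ * (_ * _`!))%N; lia.
have h4 : ((m + k + q) ^_ q * (m + k)`! = (m + k + q)`!)%N.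
  rewrite -(@ffact_fact (m + k + q) q); last by lia.
  by congr (_ * _`!)%N; lia.
apply/eqP; rewrite -(@eqn_pmul2r ((k - q)`! * (m + k)`!)) ?muln_gt0 ?fact_gt0//.
apply/eqP; transitivity ((m + k + q).+1 * (m + 2 * k)`!)%N.
  by rewrite -h1 -h2; ring.
by rewrite -h3 -h4; ring.
Qed.

End RadialMoments.

(** * Zernike moments and the reconstruction formula *)

Section ZernikeMoments.
Context {R : realType}.
Implicit Types (x : R * R) (j : int).
Notation mu := (@lebesgue_measure R).

Definition sg j : R := if 0 <= j then 1 else -1.

Lemma sg_sqr j : sg j * sg j = 1.
Proof. by rewrite /sg; case: ifP; rewrite ?mulr1 ?mulrNN ?mulr1. Qed.

Lemma radius_sqr x s : s * s = 1 -> (Defs.radius x ^+ 2)%:C = w s x * w (- s) x.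
Proof.
move=> s1; rewrite /Defs.radius sqr_sqrtr ?addr_ge0 ?sqr_ge0//.
apply: complex_ext; rewrite !parts /=; last by ring.
by rewrite !mulNr mulrN opprK mulrACA s1 mul1r.
Qed.

Lemma radius_eq0 x s : Defs.radius x = 0 -> w s x = 0.
Proof.
move/eqP; rewrite sqrtr_eq0 => h.
have /andP[/eqP h1 /eqP h2] : (x.1 == 0) && (x.2 == 0).
  rewrite -!(sqrf_eq0 x.1) -!(sqrf_eq0 x.2) -paddr_eq0 ?sqr_ge0// eq_le h.
  by rewrite addr_ge0 ?sqr_ge0.
by apply: complex_ext; rewrite /= ?h1 ?h2 ?mulr0.
Qed.

Lemma to_complexE x : to_complex x = w 1 x.
Proof. by rewrite /w mul1r. Qed.

(* At the origin both sides vanish, except for [j = 0], when both are 1. *)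
Lemma radius_angular j x : (Defs.radius x ^+ `|j|)%:C * angular j x = w (sg j) x ^+ `|j|.
Proof.
rewrite /angular to_complexE rmorphXn /=.
have [r0|r0] := eqVneq (Defs.radius x) 0.
  by rewrite r0 (radius_eq0 (sg j) r0) (radius_eq0 1 r0); case: j => [[|n]|n];
    rewrite ?mul0r ?expr0 ?mul1r// !expr0n/= mul0r.
have rC : (Defs.radius x)%:C != 0 by rewrite (fmorph_eq0 (real_complex R)).
have rsq := @radius_sqr x 1 (mulr1 1); rewrite rmorphXn /= in rsq.
case: j => n; rewrite /sg /=.
  by rewrite -exprMn mulrC divfK.
rewrite NegzE.
have w0 : w 1 x != 0.
  by apply/eqP => w0; move: rsq; rewrite w0 mul0r => /eqP; rewrite sqrf_eq0 (negPf rC).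
(* With r the radius, the base is r (w 1 / r)^-1 = r^2 / w 1 = w (-1). *)
rewrite -exprnN -exprVn -exprMn; congr (_ ^+ _).
by rewrite invfM invrK mulrCA -expr2 rsq mulrA mulVf// mul1r.
Qed.

Lemma angular_mono j p x :
  (Defs.radius x ^+ (`|j| + 2 * p))%:C * angular j x = mono (sg j) (`|j| + p) p x.
Proof.
have rp : ((Defs.radius x ^+ 2) ^+ p)%:C = (w (sg j) x * w (- sg j) x) ^+ p.
  by rewrite rmorphXn /= (radius_sqr x (sg_sqr j)).
rewrite exprD exprM rmorphM /= rp mulrAC radius_angular /mono exprD exprMn; ring.
Qed.

Definition zernike_coef (m q s : nat) : R :=
  (-1) ^+ s * 'C(m + 2 * q - s, s)%:R * 'C(m + 2 * q - 2 * s, q - s)%:R.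

(** The radial exponents exceed |j| by even numbers and r^2 = [w s] [w (- s)], so the radius
    disappears and the function is a polynomial in the coordinates, smooth also at the origin. *)
Lemma zernikeE j q x : zernike j q x =
  \sum_(0 <= s < q.+1)
    (Num.sqrt ((`|j| + 2 * q + 1)%N%:R / pi) * zernike_coef `|j| q s)%:C *
    mono (sg j) (`|j| + (q - s)) (q - s) x.
Proof.
rewrite /zernike /zernike_radial mulr_sumr rmorph_sum /= mulr_suml.
apply: eq_big_nat => s /andP[_ sq]; rewrite -angular_mono /zernike_coef.
rewrite (_ : `|j| + 2 * q - 2 * s = `|j| + 2 * (q - s))%N; last by lia.
by rewrite [RHS]mulrA -rmorphM /=; congr (_%:C * _); ring.
Qed.

Lemma cCk_zernike n j q : cCk n (@zernike R j q).
Proof.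
rewrite (_ : zernike j q = (fun x => \sum_(0 <= s < q.+1)
    (Num.sqrt ((`|j| + 2 * q + 1)%N%:R / pi) * zernike_coef `|j| q s)%:C *
    mono (sg j) (`|j| + (q - s)) (q - s) x)); last by apply/funext => x; exact: zernikeE.
elim: (index_iota 0 q.+1) => [|s r IH].
  by under eq_fun do rewrite big_nil; exact: cCk_cst.
under eq_fun do rewrite big_cons.
by apply: cCkD => //; apply: cCkM; [exact: cCk_cst|exact: cCk_mono].
Qed.

Definition moment (m k q : nat) : R :=
  Num.sqrt ((m + 2 * q + 1)%N%:R / pi) * pi * ((k ^_ q)%:R / ((m + k + q).+1 ^_ q.+1)%:R).

Lemma disk_integral_monoM j j' p k :
  disk_integral (fun x => mono (sg j') (`|j'| + p) p x * mono (sg j) k (`|j| + k) x) =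
  if j' == j then (pi / (`|j| + k + p).+1%:R)%:C else 0.
Proof.
have [E|E] := eqVneq (sg j') (sg j).
  transitivity (disk_integral (mono (sg j) (`|j'| + p + k) (p + (`|j| + k)))).
    by apply: eq_cintegral => x _; rewrite E monoM.
  rewrite disk_integral_mono ?sg_sqr//.
  have -> : (`|j'| + p + k == p + (`|j| + k))%N = (j' == j).
    apply/eqP/eqP => [h|->]; last by lia.
    have {h} h : `|j'|%N = `|j|%N by lia.
    (* Equal absolute values and equal signs force j' = j, as 1 and -1 differ in [R]. *)
    move: E h; rewrite /sg; have N : (1 : R) == -1 = false.
      by rewrite eq_sym -subr_eq0 -opprD oppr_eq0 -mulr2n pnatr_eq0.
    by case: ifP; case: ifP => h1 h2 /eqP //; rewrite ?N 1?eq_sym ?N //; lia.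
  by rewrite addnC.
have E' : sg j' = - sg j.
  by move: E; rewrite /sg; case: ifP; case: ifP => _ _ //; rewrite ?opprK ?eqxx.
have jj : j' == j = false by apply/eqP => h; rewrite h eqxx in E.
transitivity (disk_integral (mono (sg j) (p + k) (`|j'| + p + (`|j| + k)))).
  by apply: eq_cintegral => x _; rewrite E' mono_swap opprK monoM.
(* For opposite signs the exponents can agree only if j and j' are both 0, hence equal. *)
rewrite disk_integral_mono ?sg_sqr// jj ifF//; apply/eqP => h.
have h0 : `|j'|%N = 0%N /\ `|j|%N = 0%N by lia.
move: jj; case: h0 => /eqP; rewrite absz_eq0 => /eqP -> /eqP.
by rewrite absz_eq0 => /eqP ->.
Qed.

Lemma disk_integral_zernike j j' k q :
  disk_integral (fun x => zernike j' q x * mono (sg j) k (`|j| + k) x) =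
  if j' == j then (moment `|j| k q)%:C else 0.
Proof.
have mD := @measurable_disk R.
pose N : R := Num.sqrt ((`|j'| + 2 * q + 1)%N%:R / pi).
pose G s x := (N * zernike_coef `|j'| q s)%:C *
  (mono (sg j') (`|j'| + (q - s)) (q - s) x * mono (sg j) k (`|j| + k) x).
have CM p : cCk 0 (fun x => mono (sg j') (`|j'| + p) p x * mono (sg j) k (`|j| + k) x).
  by apply: cCkM; exact: cCk_mono.
have iG s : cintegrable area disk (G s).
  by apply: cintegrableZ => //; exact: disk_cintegrable.
transitivity (disk_integral (fun x => \sum_(0 <= s < q.+1) G s x)).
  apply: eq_cintegral => x _; rewrite zernikeE mulr_suml.
  by apply: eq_bigr => s _; rewrite -mulrA.
have [_ E] := cintegral_sum mD (index_iota 0 q.+1) iG; apply: (etrans E).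
transitivity (\sum_(0 <= s < q.+1) (N * zernike_coef `|j'| q s)%:C *
    (if j' == j then (pi / (`|j| + k + (q - s)).+1%:R)%:C else 0)).
  apply: eq_bigr => s _; rewrite -(disk_integral_monoM j j' (q - s) k).
  by apply: cintegralZ => //; exact: disk_cintegrable.
have [jj|_] := eqVneq j' j; last by apply: big1 => s _; rewrite mulr0.
rewrite {G iG CM E}/N jj.
rewrite /moment -(zernike_radial_moment `|j| k q) mulr_sumr.
rewrite [RHS](rmorph_sum (real_complex R)); apply: eq_big_nat => s /andP[_ sq].
rewrite -rmorphM; congr (_%:C); rewrite /zernike_coef addnBA//.
move: (_.+1%:R^-1) => u; ring.
Qed.

End ZernikeMoments.

(** * Moments of [eta] in terms of its coefficients *)

Section Coefficients.
Context {R : realType}.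
Variables (eta : R * R -> R[i]) (c : int -> nat -> R[i]).
Hypotheses (eta_L2 : disk_L2 eta) (eta_exp : zernike_expansion eta c).

Lemma big_fset_line (A : {fset int * nat}) (j : int) (k : nat) (G : int -> nat -> R[i]) :
  (forall q, (q < k)%N -> (j, q) \in A) ->
  (forall p, ~~ ((p.1 == j) && (p.2 < k)%N) -> G p.1 p.2 = 0) ->
  \sum_(p <- A) G p.1 p.2 = \sum_(0 <= q < k) G j q.
Proof.
move=> jA G0; pose P (p : int * nat) := (p.1 == j) && (p.2 < k)%N.
rewrite (bigID P) /= [X in _ + X]big1 ?addr0 => [|p /G0//].
rewrite -big_filter (perm_big [seq (j, q) | q <- index_iota 0 k]); last first.
  apply: uniq_perm.
  - by rewrite filter_uniq// fset_uniq.
  - by rewrite map_inj_uniq ?iota_uniq// => a b [].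
  move=> [a b]; rewrite mem_filter /P /=; apply/idP/idP.
    move=> /andP[/andP[/eqP -> bk] _]; apply/mapP; exists b => //.
    by rewrite mem_index_iota.
  move=> /mapP[q]; rewrite mem_index_iota => /andP[_ qk] [-> ->].
  by rewrite eqxx qk jA.
by rewrite big_map.
Qed.

(** For every finite index set that contains the pairs (j, q) with q <= k, the partial sum already
    has the moment on the right. The error is the inner product of the L^2 remainder with a fixed
    monomial, hence arbitrarily small. *)
Lemma eta_moment (j : int) (k : nat) :
  disk_integral (fun x => eta x * mono (sg j) k (`|j| + k) x) =
  \sum_(0 <= q < k.+1) c j q * (moment `|j| k q)%:C.
Proof.
have mD := @measurable_disk R.
(* The exponents are exchanged because [inner] conjugates its second argument. *)
pose g : R * R -> R[i] := mono (sg j) (`|j| + k) k.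
have Lg : disk_L2 g by apply: continuous_disk_L2; exact: cCk_mono.
have Lz (p : int * nat) : disk_L2 (@zernike R p.1 p.2).
  by apply: continuous_disk_L2; exact: cCk_zernike.
have innerE f : disk_integral (fun x => f x * mono (sg j) k (`|j| + k) x) =
    inner area disk f g.
  by apply: eq_cintegral => x _; rewrite mono_conj.
rewrite innerE; apply/eqP; rewrite -subr_eq0; apply/eqP/norm1_small => e e0.
have [r r0 small] := inner_small mD Lg e0.
have [A0 HA0] := eta_exp r0.
(* Enlarging [A0] keeps the remainder small and makes all the relevant indices available. *)
pose A := (A0 `|` seq_fset tt [seq (j, q) | q <- index_iota 0 k.+1])%fset.
have Lc (p : int * nat) : disk_L2 (fun x => c p.1 p.2 * zernike p.1 p.2 x) :=
  L2Z mD (c p.1 p.2) (Lz p).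
have LS := L2_sum mD A Lc.
have [_] := small _ (L2B mD eta_L2 LS) (HA0 A (fsubsetUl _ _)).
rewrite innerB// inner_sum//.
rewrite (_ : \sum_(p <- A) _ = \sum_(0 <= q < k.+1) c j q * (moment `|j| k q)%:C)//.
have T p : inner area disk (fun x => c p.1 p.2 * zernike p.1 p.2 x) g =
    c p.1 p.2 * (if p.1 == j then (moment `|j| k p.2)%:C else 0).
  rewrite -(disk_integral_zernike j p.1 k p.2) innerE.
  exact: (innerZ mD (c p.1 p.2) (Lz p) Lg).
rewrite (eq_bigr _ (fun p _ => T p)).
rewrite (@big_fset_line A j k.+1
  (fun a q => c a q * (if a == j then (moment `|j| k q)%:C else 0))).
- by apply: eq_bigr => q _; rewrite eqxx.
- move=> q qk; rewrite /A in_fsetU; apply/orP; right; rewrite seq_fsetE.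
  by apply/mapP; exists q => //; rewrite mem_index_iota.
- move=> [a q] /=; case: eqP => [_|_]; last by rewrite mulr0.
  rewrite /= -leqNgt => kq; rewrite /moment ffact_small// mul0r mulr0.
  by rewrite mulr0.
Qed.

End Coefficients.

(** * The boundary data and the product of their potentials' gradients *)

Section FourierData.
Context {R : realType}.
Implicit Types (j : int).
Notation mu := (@lebesgue_measure R).

(** On the circle the inverse of z is its conjugate, so negative frequencies become powers of
    [w (-1)]. *)
Lemma fourier_circle j n t :
  fourier (sgn j * n%:Z) (circle_pt t) =
  (@kappa R)%:C * w (sg j) (circle_pt t) ^+ n.
Proof.
have r1 : Defs.radius (circle_pt t) = 1 :> R.
  by rewrite /Defs.radius /circle_pt /= cos2Dsin2 sqrtr1.
rewrite /fourier -/kappa; congr (_ * _); rewrite /angular r1 divr1 to_complexE.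
rewrite /sgn /sg; case: ifP => _; first by rewrite mul1r.
rewrite mulN1r -exprnN -exprVn; congr (_ ^+ _).
have ww := wM_circle t (mulr1 (1 : R)).
have w0 : w 1 (circle_pt t) != 0.
  by apply/eqP => w0; move/eqP: ww; rewrite w0 mul0r eq_sym oner_eq0.
by apply: (mulfI w0); rewrite mulfV.
Qed.

Lemma fourier_L2 j n : circle_L2 (@fourier R (sgn j * n%:Z)).
Proof.
have : circle_L2 (fun x => (@kappa R)%:C * w (sg j) x ^+ n).
  apply: continuous_circle_L2; apply: cCkM; first exact: cCk_cst.
  by apply: cCkX; exact: cCk_w.
rewrite /circle_L2; congr (L2 _ _ _); apply/funext => t /=.
by rewrite fourier_circle.
Qed.

Lemma fourier_mean0 j n : circle_L2_mean0 (@fourier R (sgn j * n.+1%:Z)).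
Proof.
split; first exact: fourier_L2.
have w0 := circle_w n (@sg_sqr R j).
transitivity (circle_integral (fun x => (@kappa R)%:C * w (sg j) x ^+ n.+1)).
  by apply: eq_cintegral => t _ /=; rewrite fourier_circle conjC1 mulr1.
rewrite [LHS](cintegralZ (@measurable_angles R)).
  by rewrite -[X in _ * X]/(circle_integral (fun x => w (sg j) x ^+ n.+1)) w0 mulr0.
apply: (@circle_cintegrable _ (fun x => w (sg j) x ^+ n.+1)).
by apply: cCkX; exact: cCk_w.
Qed.

Lemma kappa_sqr : kappa * kappa = (2 * pi)^-1 :> R.
Proof.
by rewrite /kappa -invfM -expr2 sqr_sqrtr// mulr_ge0// pi_ge0.
Qed.

(** The constant vector [dw s] has squared length 2, and 2 kappa^2 = 1 / pi. *)
Lemma grad_dot_potential s a b (x : R * R) : s * s = 1 ->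
  grad_dot (smooth_H1 (csmooth_potential s a)) (smooth_H1 (csmooth_potential s b)) x =
  (pi^-1)%:C * mono s a b x.
Proof.
move=> s1; rewrite /grad_dot sum_I2 /= !partial_potential /dw /=.
rewrite !rmorphM !rmorphXn /= !wJ rmorph1.
have -> : ((imag s)^*)%R = - imag s by apply: complex_ext; rewrite !parts //= oppr0.
have -> : (((@kappa R)%:C)^*)%R = (@kappa R)%:C.
  by apply: complex_ext; rewrite !parts //= oppr0.
rewrite /mono.
transitivity ((@kappa R)%:C * (@kappa R)%:C * (w s x ^+ a * w (- s) x ^+ b) *
  (1 - imag s * imag s)); first by ring.
rewrite imag_sqr// -rmorphM kappa_sqr opprK.
rewrite mulrAC (_ : _ * (1 + 1) = (pi^-1)%:C)//.
rewrite -(rmorph1 (real_complex R)) -rmorphD -rmorphM; congr (_%:C).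
move: (@pi R) (pi_gt0 R) => p p0.
by field; rewrite gt_eqF.
Qed.

End FourierData.

(** Identifies the factor of [c j q] in the rescaled k-th moment equation. The powers of pi cancel:
    the prefactor contributes sqrt pi, and 1 / pi times the moment contributes its inverse. *)
Lemma coefficient_identity (R : realType) (m k q : nat) : (q <= k)%N ->
  Num.sqrt (pi * (m + 2 * k + 1)%N%:R) * 'C(m + 2 * k, k)%:R * (pi^-1 * moment m k q) =
  Num.sqrt ((m + 2 * k + 1)%N%:R * (m + 2 * q + 1)%N%:R) / (m + k + q + 1)%N%:R *
    'C(m + 2 * k, k - q)%:R :> R.
Proof.
move=> qk; rewrite /moment; move: (@pi R) (pi_gt0 R) => p p0.
have -> : Num.sqrt ((m + 2 * k + 1)%N%:R * (m + 2 * q + 1)%N%:R) =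
    Num.sqrt (p * (m + 2 * k + 1)%N%:R) * Num.sqrt ((m + 2 * q + 1)%N%:R / p) :> R.
  rewrite -sqrtrM; last by rewrite mulr_ge0// ltW.
  by congr Num.sqrt; field; rewrite gt_eqF.
rewrite [(m + k + q + 1)%N]addn1.
have E := congr1 (fun n => n%:R : R) (bin_ffact_shift m qk).
rewrite natrM natrM [X in _ = X]natrM in E.
have h1 : (m + k + q).+1%:R != 0 :> R by rewrite pnatr_eq0.
have h2 : ((m + k + q).+1 ^_ q.+1)%:R != 0 :> R.
  by rewrite pnatr_eq0 -lt0n ffact_gt0; lia.
move: E h1 h2; move: ((m + k + q).+1%:R) => u.
move: ((m + k + q).+1 ^_ q.+1)%:R => v E u0 v0.
have -> : 'C(m + 2 * k, k - q)%:R = 'C(m + 2 * k, k)%:R * (k ^_ q)%:R * u / v :> R.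
  by rewrite E mulfK.
by field; rewrite u0 v0 gt_eqF.
Qed.

Theorem theorem1p3 (R : realType) (eta : R * R -> R[i])
    (c : int -> nat -> R[i]) (Feta : (R * R -> R[i]) -> (R * R -> R[i]))
    (eta_L2 : disk_L2 eta)
    (c_ell2 : ell2 c)
    (eta_expansion : zernike_expansion eta c)
    (Feta_def : is_F eta Feta)
    (j : int) (k : nat) :
  c j k =
    - (Num.sqrt (pi * (`|j| + 2 * k + 1)%N%:R) *
       ('C(`|j| + 2 * k, k))%:R)%:C *
      circle_inner (Feta (fourier (sgn j * k.+1%:Z)))
                   (fourier (sgn j * (`|j| + k + 1)%N%:Z))
    - \sum_(0 <= q < k)
        c j q *
        (Num.sqrt ((`|j| + 2 * k + 1)%N%:R * (`|j| + 2 * q + 1)%N%:R) /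
         (`|j| + k + q + 1)%N%:R * ('C(`|j| + 2 * k, k - q))%:R)%:C.
Proof.
have ss := @sg_sqr R j; rewrite [(`|j| + k + 1)%N]addn1.
have Nu := potential_neumann ss (fourier_L2 j k.+1) (fourier_circle j k.+1).
have Nv := potential_neumann ss (fourier_L2 j (`|j| + k).+1)
  (fourier_circle j (`|j| + k).+1).
rewrite (F_form Feta_def (fourier_mean0 j k) (fourier_mean0 j (`|j| + k)) Nu Nv).
have -> : disk_integral (fun x => eta x * grad_dot
      (smooth_H1 (csmooth_potential (sg j) k))
      (smooth_H1 (csmooth_potential (sg j) (`|j| + k))) x) =
    (pi^-1)%:C * disk_integral (fun x => eta x * mono (sg j) k (`|j| + k) x).
  rewrite -[RHS](cintegralZ (@measurable_disk R)).
    by apply: eq_cintegral => x _; rewrite grad_dot_potential// mulrCA.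
  have Lg : disk_L2 (mono (sg j) (`|j| + k) k : R * R -> R[i]).
    by apply: continuous_disk_L2; exact: cCk_mono.
  apply: eq_cintegrable (inner_integrable (@measurable_disk R) eta_L2 Lg).
    exact: measurable_disk.
  by move=> x _; rewrite mono_conj.
(* The minus sign of the form defining [Feta] cancels the one in front of the binomial prefactor. *)
rewrite (eta_moment eta_L2 eta_expansion) mulNr mulrN opprK mulrA -rmorphM mulr_sumr.
have T q : (q <= k)%N ->
    (Num.sqrt (pi * (`|j| + 2 * k + 1)%N%:R) * 'C(`|j| + 2 * k, k)%:R / pi)%:C *
      (c j q * (moment `|j| k q)%:C) =
    c j q * (Num.sqrt ((`|j| + 2 * k + 1)%N%:R * (`|j| + 2 * q + 1)%N%:R) /
      (`|j| + k + q + 1)%N%:R * ('C(`|j| + 2 * k, k - q))%:R)%:C.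
  move=> qk; rewrite mulrCA -rmorphM /=; congr (_ * _%:C).
  by rewrite -coefficient_identity// [RHS]mulrA.
rewrite big_nat_recr//=.
rewrite (eq_big_nat _ _ (F2 := fun q => c j q * _)
  (fun q qk => T q (ltnW (andP qk).2))).
(* The sums over q < k cancel. In the term q = k the coefficient is sqrt (N^2) / N with N = |j| + 2
   k + 1, that is 1, so [c j k] remains. *)
rewrite addrC addrK T// subnn bin0 mulr1 -expr2 sqrtr_sqr ger0_norm ?ler0n//.
rewrite (_ : `|j| + k + k + 1 = `|j| + 2 * k + 1)%N; last by lia.
by rewrite divff ?mulr1// pnatr_eq0 addn1.
Qed.
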